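(* Let $V_1,V_2$ be two commuting polynomial vector fields on $\mathbb{C}^n$ and let $\mathcal{F}$ be the foliation they generate. Let $p\in\mathbb{C}^n$ be a nonsingular point of $\mathcal{F}$ (so $V_1(p),V_2(p)$ are linearly independent), and let $\mathcal{L}$ be the (two-dimensional) leaf of $\mathcal{F}$ through $p$. Let $F,G\in\mathbb{C}[x_1,\dots,x_n]$ be polynomials whose restrictions $F|_{\mathcal{L}},G|_{\mathcal{L}}$ are not identically zero near $p$. In the ring $\mathcal{O}_p(\mathcal{L})$ of germs at $p$ of holomorphic functions on $\mathcal{L}$ (a factorial ring isomorphic to $\mathbb{C}\{x,y\}$), write $$F|_{\mathcal{L}}=h_f\, f,\qquad G|_{\mathcal{L}}=h_g\, g,$$ where $h_f$ (resp. $h_g$) is the product, with multiplicities, of those irreducible factors of $F|_{\mathcal{L}}$ (resp. $G|_{\mathcal{L}}$) that are common to $F|_{\mathcal{L}}$ and $G|_{\mathcal{L}}$ (the common factors may appear in $h_f$ and $h_g$ with different multiplicities), and $f,g$ consist of the remaining factors. Let $\mathcal{I}=\langle f,g\rangle\subset\mathcal{O}_p(\mathcal{L})$. Then $\operatorname{mult}_p\mathcal{I}=\dim_{\mathbb{C}}\mathcal{O}_p(\mathcal{L})/\mathcal{I}$ can be bounded from above by a quantity depending only on $n$ and the degrees of $V_1,V_2,F,G$.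
   Context: A leaf of $\mathcal{F}$ is a maximal connected integral surface of the distribution spanned by $V_1,V_2$. The decomposition $F|_{\mathcal{L}}=h_f f$, $G|_{\mathcal{L}}=h_g g$ is defined only on $\mathcal{L}$ near $p$ and need not extend off $\mathcal{L}$. *)

(* Defs.v *)
From HB Require Import structures.
From mathcomp Require Import all_boot all_order all_algebra.
From mathcomp Require Import mpoly complex reals.

Set Implicit Arguments.
Unset Strict Implicit.
Unset Printing Implicit Defensive.

Import Order.TTheory GRing.Theory Num.Theory.
Local Open Scope ring_scope.

Section Germs.
Variable R : realType.
Local Notation C := (R[i]).

(* A formal power series in two variables (s,t) with complex coefficients:
   a i j is the coefficient of s^i t^j. *)
Definition ps := nat -> nat -> C.

(* Convergent power series (germs of holomorphic functions at 0 in C^2):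
   the coefficients satisfy a Cauchy estimate |a_ij| r^(i+j) <= M. *)
Definition convergent (a : ps) : Prop :=
  exists r M : C, 0 < r /\ forall i j, `|a i j| * r ^+ (i + j) <= M.

(* Truncation of a series to a bivariate polynomial: outer variable s,
   inner variable t. *)
Definition trunc (N : nat) (a : ps) : {poly {poly C}} :=
  \poly_(i < N.+1) \poly_(j < N.+1) a i j.

Definition ps0 : ps := fun _ _ => 0.
Definition ps1 : ps := fun i j => if (i == 0)%N && (j == 0)%N then 1 else 0.
Definition psadd (a b : ps) : ps := fun i j => a i j + b i j.
Definition psscale (c : C) (a : ps) : ps := fun i j => c * a i j.
Definition psmul (a b : ps) : ps :=
  fun i j => ((trunc (i + j) a * trunc (i + j) b)`_i)`_j.

Definition psds (a : ps) : ps := fun i j => i.+1%:R * a i.+1 j.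
Definition psdt (a : ps) : ps := fun i j => j.+1%:R * a i j.+1.

Definition pscomp (n : nat) (F : {mpoly C[n]}) (phi : 'I_n -> ps) : ps :=
  fun i j =>
    ((mmap (fun c : C => c%:P%:P) (fun k => trunc (i + j) (phi k)) F)`_i)`_j.

Definition psunit (a : ps) : Prop :=
  exists b, convergent b /\ psmul a b = ps1.
Definition psdvd (a b : ps) : Prop :=
  exists c, convergent c /\ b = psmul a c.
Definition psirreducible (a : ps) : Prop :=
  [/\ convergent a, a <> ps0, ~ psunit a &
      forall b c, convergent b -> convergent c -> a = psmul b c ->
        psunit b \/ psunit c].

Definition in_ideal2 (f g x : ps) : Prop :=
  exists a b, [/\ convergent a, convergent b &
                  x = psadd (psmul a f) (psmul b g)].

(* dim_C O/<f,g> <= N : any N+1 elements of O are linearly dependent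
   modulo <f,g>. *)
Definition colength_le (f g : ps) (N : nat) : Prop :=
  forall x : 'I_N.+1 -> ps, (forall k, convergent (x k)) ->
    exists c : 'I_N.+1 -> C, (exists k, c k != 0) /\
      in_ideal2 f g (fun i j => \sum_(k < N.+1) c k * x k i j).

Definition common_factor_split (FL GL hf f hg g : ps) : Prop :=
  [/\ convergent hf /\ convergent f, convergent hg /\ convergent g,
      FL = psmul hf f, GL = psmul hg g &
      forall q, psirreducible q ->
        [/\ (psdvd q hf -> psdvd q GL), (psdvd q f -> ~ psdvd q GL),
            (psdvd q hg -> psdvd q FL) & (psdvd q g -> ~ psdvd q FL)]].

End Germs.

Section VF.
Variable R : realType.
Local Notation C := (R[i]).
Variable n : nat.

Definition vfield := 'I_n -> {mpoly C[n]}.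

Definition mdegree (P : {mpoly C[n]}) : nat := (msize P).-1.
Definition vdegree (V : vfield) : nat := \max_(k < n) mdegree (V k).

Definition meval_pt (v : 'I_n -> C) (P : {mpoly C[n]}) : C := mmap idfun v P.

Definition vf_commute (V W : vfield) : Prop :=
  forall k, \sum_(l < n) (V l * (W k)^`M(l) - W l * (V k)^`M(l)) = 0.

Definition vf_indep_at (V W : vfield) (p : 'I_n -> C) : Prop :=
  forall a b : C,
    (forall k, a * meval_pt p (V k) + b * meval_pt p (W k) = 0) ->
    a = 0 /\ b = 0.

(* phi : (C^2,0) -> (C^n,p) is the (convergent) joint flow parametrizing the
   leaf through p:  phi(0,0) = p,  d phi/ds = V1 o phi,  d phi/dt = V2 o phi.
   It identifies O_p(L) with C{s,t}, and F|_L with  F o phi. *)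
Definition leaf_param (V1 V2 : vfield) (p : 'I_n -> C) (phi : 'I_n -> ps R)
  : Prop :=
  forall k, [/\ convergent (phi k), phi k 0%N 0%N = p k,
                psds (phi k) = pscomp (V1 k) phi &
                psdt (phi k) = pscomp (V2 k) phi].

End VF.

(* Main.v *)
Require Import Defs.
From HB Require Import structures.
From mathcomp Require Import all_boot all_order all_algebra.
From mathcomp Require Import mpoly complex reals.
From mathcomp Require Import boolp ring zify.
Local Open Scope ring_scope.

(* Only the existence of a bound is claimed, so noetherianity of the space of
   parameters suffices.  Let [O = C{s,t}].

   One germ.  Strip from [F|_L] the largest power of [t] common to the whole
   family considered, leaving [F] regular of order [d] in [s], so that [O/(F)]
   is free over [C{t}] with basis [1, ..., s^(d-1)].  The [t]-saturation of the
   ideal [(F, G)] is principal, generated by some [h]; write [F = h f1] and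
   [G = h g1].  Then [f] divides [f1] and [g] divides [g1], and multiplication
   by [h] embeds [O/(f1, g1)] into the torsion of [O/(F, G)].  If the matrix of
   multiplication by [G] on [O/(F)] has rank [k] and [t^r] is the leading term
   of a nonzero [k]-minor, then [t^r] kills this torsion, so the colength is at
   most [d r].

   Families.  If there were no bound, there would be counterexamples indexed by
   [N] with colength at least [N].  The Taylor coefficients of their
   restrictions to the leaf are values of polynomials in finitely many
   parameters (the coefficients of [V1, V2, F, G] and the coordinates of [p]).
   By Hilbert's basis theorem one can pass to infinitely many [N] for which
   each such polynomial either always vanishes or vanishes finitely often.
   Then [d], [k] and [r] can be chosen independently of [N]: a contradiction. *)

Set Implicit Arguments.
Unset Strict Implicit.
Unset Printing Implicit Defensive.

Import Order.TTheory GRing.Theory Num.Theory.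

(** * The ring of convergent power series *)

Section Convergence.
Variable R : realType.
Local Notation C := (R[i]).
Implicit Types a b : ps R.

(** The Cauchy estimate as a geometric majorant with positive constants, the form in which products
    and recursions are estimated. *)
Lemma convergentP a : convergent a <->
  exists M K : C, [/\ 0 < M, 0 < K & forall i j, `|a i j| <= M * K ^+ (i + j)].
Proof.
split=> [[r [M [r0 aM]]]|[M [K [M0 K0 aM]]]].
  have M0 : 0 <= M by apply: le_trans (aM 0%N 0%N); rewrite mulr1.
  exists (M + 1), r^-1; split; rewrite ?invr_gt0 ?ltr_wpDl// => i j.
  rewrite exprVn ler_pdivlMr ?exprn_gt0//.
  by apply: le_trans (aM i j) _; rewrite lerDl.
exists K^-1, M; split; rewrite ?invr_gt0// => i j.
by rewrite exprVn ler_pdivrMr ?exprn_gt0.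
Qed.

Lemma convergent_common a b : convergent a -> convergent b ->
  exists M K : C, [/\ 0 < M, 0 < K,
    forall i j, `|a i j| <= M * K ^+ (i + j) &
    forall i j, `|b i j| <= M * K ^+ (i + j)].
Proof.
move=> /convergentP[M [K [M0 K0 aM]]] /convergentP[M' [K' [M0' K0' bM]]].
exists (M + M'), (K + K'); split; rewrite ?addr_gt0// => i j.
- apply: le_trans (aM i j) _; apply: ler_pM; rewrite ?exprn_ge0 ?(ltW M0) ?(ltW K0)//.
    by rewrite lerDl ltW.
  by rewrite lerXn2r ?nnegrE ?addr_ge0 ?(ltW K0) ?(ltW K0')// lerDl ltW.
- apply: le_trans (bM i j) _; apply: ler_pM; rewrite ?exprn_ge0 ?(ltW M0') ?(ltW K0')//.
    by rewrite lerDr ltW.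
  by rewrite lerXn2r ?nnegrE ?addr_ge0 ?(ltW K0) ?(ltW K0')// lerDr ltW.
Qed.

Lemma convergentD a b : convergent a -> convergent b -> convergent (psadd a b).
Proof.
move=> ca cb; have [M [K [M0 K0 aM bM]]] := convergent_common ca cb.
apply/convergentP; exists (M + M), K; split; rewrite ?addr_gt0// => i j.
by rewrite mulrDl; apply: le_trans (ler_normD _ _) _; apply: lerD.
Qed.

Lemma convergentN a : convergent a -> convergent (fun i j => - a i j).
Proof. by move=> [r [M [r0 aM]]]; exists r, M; split=> // i j; rewrite normrN. Qed.

Lemma convergent_fin a n :
  (forall i j, (n <= i + j)%N -> a i j = 0) -> convergent a.
Proof.
move=> a0; exists 1, (\sum_(i < n) \sum_(j < n) `|a i j|); split=> // i j.
rewrite expr1n mulr1; case: (leqP n (i + j)) => [/a0->|ijn].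
  by rewrite normr0; apply: sumr_ge0 => i' _; apply: sumr_ge0 => j' _.
have in_ : (i < n)%N by apply: leq_ltn_trans ijn; rewrite leq_addr.
have jn : (j < n)%N by apply: leq_ltn_trans ijn; rewrite leq_addl.
rewrite (bigD1 (Ordinal in_))//= (bigD1 (Ordinal jn))//= -addrA lerDl.
rewrite addr_ge0 ?sumr_ge0// => i' _; exact: sumr_ge0.
Qed.

(** Only coefficients of bidegree at most [(i, j)] enter the convolution, so truncating at [i + j]
    loses nothing. *)
Lemma psmulE a b i j : psmul a b i j =
  \sum_(k < i.+1) \sum_(l < j.+1) a k l * b (i - k)%N (j - l)%N.
Proof.
rewrite /psmul coefM coef_sum; apply: eq_bigr => k _.
rewrite coefM; apply: eq_bigr => l _.
have ki : (k <= i)%N by rewrite -ltnS.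
have lj : (l <= j)%N by rewrite -ltnS.
have H u v : (u <= i)%N -> (v <= j)%N -> forall x : ps R,
    ((trunc (i + j) x)`_u)`_v = x u v.
  move=> ui vj x; rewrite !coef_poly !ltnS (leq_trans ui) ?leq_addr//.
  by rewrite coef_poly ltnS (leq_trans vj) ?leq_addl.
by rewrite !H ?leq_subr.
Qed.

Lemma convergentM a b : convergent a -> convergent b -> convergent (psmul a b).
Proof.
move=> ca cb; have [M [K [M0 K0 aM bM]]] := convergent_common ca cb.
(* Doubling the ratio absorbs the number of terms of the convolution:
   [(i + 1) * (j + 1) <= 2 ^ (i + j)]. *)
apply/convergentP; exists (M * M), (2 * K).
split; rewrite ?mulr_gt0// => i j; rewrite psmulE.
apply: (@le_trans _ _ (\sum_(k < i.+1) \sum_(l < j.+1) M * M * K ^+ (i + j))).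
  apply: le_trans (ler_norm_sum _ _ _) _; apply: ler_sum => k _.
  apply: le_trans (ler_norm_sum _ _ _) _; apply: ler_sum => l _.
  have -> : (i + j = (k + l) + ((i - k) + (j - l)))%N.
    by rewrite addnACA !subnKC// -ltnS.
  by rewrite normrM exprD mulrACA; apply: ler_pM.
rewrite !sumr_const !card_ord -mulrnA -[leLHS]mulr_natl exprMn.
rewrite [leRHS]mulrCA; apply: ler_wpM2r.
  by rewrite !mulr_ge0 ?exprn_ge0 ?ltW.
by rewrite -natrX ler_nat mulnC expnD leq_mul// ltn_expl.
Qed.

End Convergence.

Section Ring.
Variable R : realType.
Local Notation C := (R[i]).

Record cps := Cps { cval : ps R; cvalP : convergent cval }.

Definition cf (x : cps) (i j : nat) : C := cval x i j.
Arguments cf : simpl never.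

Lemma cpsP (x y : cps) : (forall i j, cf x i j = cf y i j) -> x = y.
Proof.
case: x y => [x cx] [y cy]; rewrite /cf /= => xy.
have {xy}xy : x = y by apply/funext => i; apply/funext => j.
by rewrite xy in cx *; congr Cps; apply: Prop_irrelevance.
Qed.

HB.instance Definition _ := @gen_eqMixin cps.
HB.instance Definition _ := @gen_choiceMixin cps.

Definition cps0 := Cps (convergent_fin (n := 0) (fun _ _ _ => erefl (0 : C))).
Lemma convergent_mono (c : C) k l :
  convergent (fun i j => if (i == k)%N && (j == l)%N then c else 0).
Proof.
apply: (@convergent_fin _ _ (k + l).+1) => i j h.
by case: eqP h => [->|//]; case: eqP => [->|//]; rewrite ltnn.
Qed.
Definition mono c k l : cps := Cps (convergent_mono c k l).
Definition cps_add (x y : cps) := Cps (convergentD (cvalP x) (cvalP y)).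
Definition cps_opp (x : cps) := Cps (convergentN (cvalP x)).
Definition cps_mul (x y : cps) := Cps (convergentM (cvalP x) (cvalP y)).

Lemma cps_addA : associative cps_add.
Proof. by move=> x y z; apply: cpsP => i j; apply: addrA. Qed.
Lemma cps_addC : commutative cps_add.
Proof. by move=> x y; apply: cpsP => i j; apply: addrC. Qed.
Lemma cps_add0 : left_id cps0 cps_add.
Proof. by move=> x; apply: cpsP => i j; apply: add0r. Qed.
Lemma cps_addN : left_inverse cps0 cps_opp cps_add.
Proof. by move=> x; apply: cpsP => i j; apply: addNr. Qed.

HB.instance Definition _ :=
  GRing.isZmodule.Build cps cps_addA cps_addC cps_add0 cps_addN.

(* [P] represents [x] up to bidegree [(n, n)]; ring identities for series are
   inherited from those of polynomials. *)
Definition agree n (x : cps) (P : {poly {poly C}}) :=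
  forall i j, (i <= n)%N -> (j <= n)%N -> cf x i j = P`_i`_j.

Lemma agree_trunc n x : agree n x (trunc n (cval x)).
Proof.
by move=> i j ni nj; rewrite /trunc coef_poly ltnS ni coef_poly ltnS nj.
Qed.

Lemma agree_mul n x y P Q :
  agree n x P -> agree n y Q -> agree n (cps_mul x y) (P * Q).
Proof.
move=> xP yQ i j ni nj; rewrite /cf /= psmulE coefM coef_sum.
apply: eq_bigr => k _; rewrite coefM; apply: eq_bigr => l _.
have ki : (k <= i)%N by rewrite -ltnS.
have lj : (l <= j)%N by rewrite -ltnS.
congr (_ * _); first by apply: xP; [apply: leq_trans ni|apply: leq_trans nj].
by apply: yQ; rewrite (leq_trans (leq_subr _ _)).
Qed.

Lemma agree_add n x y P Q :
  agree n x P -> agree n y Q -> agree n (x + y) (P + Q).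
Proof. by move=> xP yQ i j ni nj; rewrite !coefD -xP// -yQ. Qed.

Lemma agree_eq x y (P : nat -> {poly {poly C}}) :
  (forall n, agree n x (P n)) -> (forall n, agree n y (P n)) -> x = y.
Proof.
move=> xP yP; apply: cpsP => i j.
by rewrite (xP (i + j)%N) ?leq_addr ?leq_addl// -yP ?leq_addr ?leq_addl.
Qed.

Lemma agree1 n : agree n (mono 1 0 0) 1.
Proof.
move=> i j _ _; rewrite coef1 /cf /=.
by case: eqP => _; rewrite /= ?coef1 ?coef0//; case: eqP.
Qed.

Lemma cps_mulA : associative cps_mul.
Proof.
move=> x y z; pose T n x := trunc n (cval x).
apply: (@agree_eq _ _ (fun n => T n x * (T n y * T n z))) => n.
  by apply: agree_mul (agree_mul _ _); exact: agree_trunc.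
by rewrite mulrA; apply: agree_mul (agree_mul _ _) _; exact: agree_trunc.
Qed.

Lemma cps_mulC : commutative cps_mul.
Proof.
move=> x y; pose T n x := trunc n (cval x).
apply: (@agree_eq _ _ (fun n => T n x * T n y)) => n; last rewrite mulrC;
  by apply: agree_mul; exact: agree_trunc.
Qed.

Lemma cps_mul1 : left_id (mono 1 0 0) cps_mul.
Proof.
move=> x; pose T n x := trunc n (cval x).
apply: (@agree_eq _ _ (fun n => 1 * T n x)) => n.
  by apply: agree_mul; [exact: agree1|exact: agree_trunc].
by rewrite mul1r; exact: agree_trunc.
Qed.

Lemma cps_mulDl : left_distributive cps_mul +%R.
Proof.
move=> x y z; pose T n x := trunc n (cval x).
apply: (@agree_eq _ _ (fun n => (T n x + T n y) * T n z)) => n.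
  by apply: agree_mul; [apply: agree_add|]; exact: agree_trunc.
by rewrite mulrDl; apply: agree_add; apply: agree_mul; exact: agree_trunc.
Qed.

Lemma mono1_neq0 : mono 1 0 0 != 0 :> cps.
Proof.
by apply/eqP => /(congr1 (fun x => cf x 0 0)) /eqP; rewrite /cf /= oner_eq0.
Qed.

HB.instance Definition _ := GRing.Zmodule_isComNzRing.Build cps
  cps_mulA cps_mulC cps_mul1 cps_mulDl mono1_neq0.

Implicit Types x y z : cps.

Lemma cf0 i j : cf 0 i j = 0. Proof. by []. Qed.
Lemma cfD x y i j : cf (x + y) i j = cf x i j + cf y i j. Proof. by []. Qed.
Lemma cfN x i j : cf (- x) i j = - cf x i j. Proof. by []. Qed.
Lemma cfB x y i j : cf (x - y) i j = cf x i j - cf y i j. Proof. by []. Qed.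
Lemma cf1 i j : cf 1 i j = ((i == 0)%N && (j == 0)%N)%:R.
Proof. by rewrite /cf /=; case: ifP. Qed.
Lemma cfM x y i j : cf (x * y) i j =
  \sum_(k < i.+1) \sum_(l < j.+1) cf x k l * cf y (i - k) (j - l).
Proof. exact: psmulE. Qed.
Lemma cf_sum I (r : seq I) (P : pred I) (F : I -> cps) i j :
  cf (\sum_(k <- r | P k) F k) i j = \sum_(k <- r | P k) cf (F k) i j.
Proof. by elim/big_rec2: _ => // k u v _ <-. Qed.

Lemma cf_mono c k l i j :
  cf (mono c k l) i j = c *+ ((i == k)%N && (j == l)%N).
Proof. by rewrite /cf /=; case: ifP. Qed.

Lemma cf_monoM c k l x i j : cf (mono c k l * x) i j =
  if (k <= i)%N && (l <= j)%N then c * cf x (i - k) (j - l) else 0.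
Proof.
rewrite cfM; case: ifP => [/andP[ki lj]|h].
  rewrite (bigD1 (Ordinal (ki : (k < i.+1)%N)))//=.
  rewrite (bigD1 (Ordinal (lj : (l < j.+1)%N)))//=.
  rewrite cf_mono !eqxx [X in _ + X]big1 => [|k' k'k]; last first.
    apply: big1 => l' _; rewrite cf_mono -val_eqE /= in k'k *.
    by rewrite (negbTE k'k) mul0r.
  rewrite [X in _ + X + _]big1 ?addr0// => l' l'l.
  by rewrite cf_mono -val_eqE /= in l'l *; rewrite (negbTE l'l) andbF mul0r.
apply: big1 => k' _; apply: big1 => l' _; rewrite cf_mono.
case: eqP => [k'k|]; last by rewrite mul0r.
case: eqP => [l'l|]; last by rewrite mul0r.
by move: h (ltn_ord k') (ltn_ord l'); rewrite k'k l'l !ltnS => /[swap] -> /[swap] ->.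
Qed.

Lemma mono_mul c c' k l k' l' :
  mono c k l * mono c' k' l' = mono (c * c') (k + k') (l + l').
Proof.
apply: cpsP => i j; rewrite cf_monoM !cf_mono.
case: (leqP k i) => ki /=; last by rewrite ltn_eqF// ltn_addr.
case: (leqP l j) => lj /=; last by rewrite [X in _ && X]ltn_eqF ?andbF// ltn_addr.
by rewrite -{2}(subnKC ki) -{2}(subnKC lj) !eqn_add2l mulrnAr.
Qed.

End Ring.

Arguments cf : simpl never.

(** * Weierstrass division *)

Section StrongRecursion.
Variables (A : Type) (a0 : A) (Phi : (nat -> A) -> nat -> A).

(** If [Phi u n] consults [u] only below [n], each round of iteration makes one more value final, so
    [n.+1] rounds suffice for the value at [n]. *)
Definition srec (n : nat) : A := iter n.+1 Phi (fun=> a0) n.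

Lemma srecE :
  (forall u v n, (forall m, (m < n)%N -> u m = v m) -> Phi u n = Phi v n) ->
  forall n, srec n = Phi srec n.
Proof.
move=> PhiE.
have stab n k m : (m < n)%N ->
    iter n Phi (fun=> a0) m = iter (n + k) Phi (fun=> a0) m.
  elim: n m => // n IH m mn; rewrite addSn !iterS; apply: PhiE => m' m'm.
  by apply: IH; apply: leq_trans m'm _.
move=> n; rewrite {1}/srec iterS; apply: PhiE => m mn.
by rewrite /srec -(subnKC mn) -stab.
Qed.

End StrongRecursion.

Section GeometricSum.
Variable F : numFieldType.

(** Each summand is [K ^+ n * P ^+ a], and [P - 1 >= P / 2]. The factor [1 / P] is the gain that
    closes the majorant in Weierstrass division. *)
Lemma geometric_sum_lt (K P : F) n : 0 < K -> 2 <= P ->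
  \sum_(a < n) (K * P) ^+ a * K ^+ (n - a) <= 2 / P * (K * P) ^+ n.
Proof.
move=> K0 P2; have P0 : 0 < P by apply: lt_le_trans P2.
elim: n => [|n IH]; first by rewrite big_ord0 mulr1 divr_ge0 ?(ltW P0).
rewrite big_ord_recr /= subSnn expr1.
have -> : \sum_(i < n) (K * P) ^+ i * K ^+ (n.+1 - i) =
          K * \sum_(i < n) (K * P) ^+ i * K ^+ (n - i).
  rewrite mulr_sumr; apply: eq_bigr => i _.
  by rewrite subSn ?(ltnW (ltn_ord i))// exprS mulrCA.
apply: (@le_trans _ _ (K * (2 / P * (K * P) ^+ n) + (K * P) ^+ n * K)).
  by rewrite lerD2r ler_pM2l.
have -> : 2 / P * (K * P) ^+ n.+1 = K * (K * P) ^+ n * 2.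
  by rewrite exprS; field; rewrite gt_eqF.
have -> : K * (2 / P * (K * P) ^+ n) + (K * P) ^+ n * K =
          K * (K * P) ^+ n * (2 / P + 1) by ring.
apply: ler_wpM2l; first by rewrite mulr_ge0 ?exprn_ge0 ?mulr_ge0 ?ltW.
by rewrite -lerBrDr (_ : 2 - 1 = 1); [rewrite ler_pdivrMr ?mul1r|ring].
Qed.

Lemma geometric_sum_le (K P : F) n : 0 < K -> 2 <= P ->
  \sum_(a < n.+1) (K * P) ^+ a * K ^+ (n - a) <= 2 * (K * P) ^+ n.
Proof.
move=> K0 P2; have P0 : 0 < P by apply: lt_le_trans P2.
rewrite big_ord_recr /= subnn mulr1.
apply: (@le_trans _ _ (2 / P * (K * P) ^+ n + (K * P) ^+ n)).
  by rewrite lerD2r; exact: geometric_sum_lt.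
rewrite [leRHS]mulr_natl mulr2n lerD2r ler_piMl//.
  by rewrite exprn_ge0 ?mulr_ge0 ?ltW.
by rewrite ler_pdivrMr ?mul1r.
Qed.

End GeometricSum.

Section Weierstrass.
Variable R : realType.
Local Notation C := (R[i]).
Local Notation O := (cps R).
Implicit Types x y z : O.

(* [s^i t^j] is the lowest monomial of [x], monomials being ordered by their
   exponent in [t] first; [lead x d 0] says that [x] is regular of order [d]
   in [s]. *)
Definition lead x i j :=
  [/\ forall k l, (l < j)%N -> cf x k l = 0,
      forall k, (k < i)%N -> cf x k j = 0 & cf x i j != 0].

Lemma cps_neq0P x : x != 0 -> exists i j, cf x i j != 0.
Proof.
apply: contra_neqP => /forallNP h; apply: cpsP => i j; rewrite cf0.
by have /forallNP/(_ j)/negP := h i; rewrite negbK => /eqP.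
Qed.

Lemma lead_exists x : x != 0 -> exists i j, lead x i j.
Proof.
move=> /cps_neq0P[i0 [j0 x0]].
have ex : exists j, `[< exists i, cf x i j != 0 >].
  by exists j0; apply/asboolP; exists i0.
case: (ex_minnP ex) => j /asboolP exi jmin.
case: (ex_minnP exi) => i xij imin; exists i, j; split=> // [k l lj|k ki].
  apply/eqP; apply: contraTT lj => xkl; rewrite -leqNgt; apply: jmin.
  by apply/asboolP; exists k.
by apply/eqP; apply: contraTT ki => xkj; rewrite -leqNgt; exact: imin.
Qed.

Lemma lead_neq0 x i j : lead x i j -> x != 0.
Proof. by case=> _ _; apply: contraNneq => ->; rewrite cf0. Qed.

(** The order on monomials is compatible with products, so every other term of the convolution
    contains a coefficient below the lowest monomial of [x] or of [y]. *)
Lemma lead_mul_cf x y i j i' j' : lead x i j -> lead y i' j' ->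
  cf (x * y) (i + i') (j + j') = cf x i j * cf y i' j'.
Proof.
case=> xl xk xij [yl yk yij]; rewrite cfM.
have iI : (i < (i + i').+1)%N by rewrite ltnS leq_addr.
have jJ : (j < (j + j').+1)%N by rewrite ltnS leq_addr.
rewrite (bigD1 (Ordinal iI))//= (bigD1 (Ordinal jJ))//= !addKn.
rewrite [X in _ + X + _]big1 => [|l /eqP lj].
  rewrite addr0 [X in _ + X]big1 ?addr0// => k /eqP ki; apply: big1 => l _.
  have {}ki : (k : nat) <> i by move=> h; apply: ki; apply: val_inj.
  case: (ltngtP l j) => [lj|lj|lj]; first by rewrite xl ?mul0r.
    by rewrite yl ?mulr0//; have := ltn_ord l; lia.
  rewrite lj; case: (ltngtP k i) => [?|?|//]; first by rewrite xk ?mul0r.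
  by rewrite addKn yk ?mulr0// ltn_subLR ?ltn_add2r// -ltnS.
have {}lj : (l : nat) <> j by move=> h; apply: lj; apply: val_inj.
case: (ltngtP l j) => [?|?|//]; first by rewrite xl ?mul0r.
by rewrite yl ?mulr0//; have := ltn_ord l; lia.
Qed.

Lemma lead_mul x y i j i' j' : lead x i j -> lead y i' j' ->
  lead (x * y) (i + i') (j + j').
Proof.
move=> lx ly; have xy := lead_mul_cf lx ly.
case: lx ly => xl xk xij [yl yk yij].
split; last by rewrite xy mulf_neq0.
- move=> k l ll; rewrite cfM; apply: big1 => a _; apply: big1 => b _.
  case: (ltnP b j) => [?|jb]; first by rewrite xl ?mul0r.
  by rewrite yl ?mulr0//; have := ltn_ord b; lia.
- move=> k kk; rewrite cfM; apply: big1 => a _; apply: big1 => b _.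
  case: (ltngtP b j) => [bj|bj|bj]; first by rewrite xl ?mul0r.
    by rewrite yl ?mulr0//; have := ltn_ord b; lia.
  rewrite bj addKn; case: (ltnP a i) => [?|ia]; first by rewrite xk ?mul0r.
  by rewrite yk ?mulr0//; have := ltn_ord a; lia.
Qed.

Lemma lead_uniq x i j i' j' : lead x i j -> lead x i' j' -> i = i' /\ j = j'.
Proof.
move=> [xl xk xij] [xl' xk' xij'].
have jj : j = j'.
  by case: (ltngtP j j') => // h; [rewrite xl' ?eqxx in xij|rewrite xl ?eqxx in xij'].
split=> //; subst j'.
by case: (ltngtP i i') => // h; [rewrite xk' ?eqxx in xij|rewrite xk ?eqxx in xij'].
Qed.

Lemma cps_mulf_eq0 x y : x * y = 0 -> x = 0 \/ y = 0.
Proof.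
case: (eqVneq x 0) => [|/lead_exists[i [j lx]]]; first by left.
case: (eqVneq y 0) => [|/lead_exists[k [l ly]]]; first by right.
by move=> xy; have /lead_neq0 := lead_mul lx ly; rewrite xy eqxx.
Qed.

Lemma cps_mulfI x y z : x != 0 -> x * y = x * z -> y = z.
Proof.
move=> x0 /eqP; rewrite -subr_eq0 -mulrBr => /eqP/cps_mulf_eq0[/eqP|/eqP].
  by rewrite (negbTE x0).
by rewrite subr_eq0 => /eqP.
Qed.

Lemma lead_mul_inv x y i j : lead (x * y) i j ->
  exists i1 j1 i2 j2,
    [/\ lead x i1 j1, lead y i2 j2, i = (i1 + i2)%N & j = (j1 + j2)%N].
Proof.
move=> lxy; have := lead_neq0 lxy.
case: (eqVneq x 0) => [->|/lead_exists[i1 [j1 lx]]]; first by rewrite mul0r eqxx.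
case: (eqVneq y 0) => [->|/lead_exists[i2 [j2 ly]]]; first by rewrite mulr0 eqxx.
have [-> ->] := lead_uniq lxy (lead_mul lx ly).
by exists i1, j1, i2, j2.
Qed.

Lemma regular_mul_inv x y d : lead (x * y) d 0 ->
  exists a b, [/\ lead x a 0, lead y b 0 & d = (a + b)%N].
Proof.
move=> /lead_mul_inv[a [j1 [b [j2 [lx ly -> /esym/eqP]]]]].
by rewrite addn_eq0 => /andP[/eqP j10 /eqP j20]; subst j1 j2; exists a, b.
Qed.

Definition tX m : O := mono 1 0 m.

Lemma cf_tXM m x i j :
  cf (tX m * x) i j = if (m <= j)%N then cf x i (j - m) else 0.
Proof. by rewrite cf_monoM /= subn0 mul1r. Qed.

Lemma tX0 : tX 0 = 1.
Proof. by []. Qed.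

Lemma tXD m n : tX (m + n) = tX m * tX n.
Proof. by rewrite mono_mul mulr1. Qed.

Lemma lead_tX m : lead (tX m) 0 m.
Proof.
split=> // [k l lm|]; first by rewrite cf_mono (ltn_eqF lm) andbF.
by rewrite cf_mono !eqxx oner_eq0.
Qed.

Lemma tX_neq0 m : tX m != 0.
Proof. exact: lead_neq0 (lead_tX m). Qed.

Lemma convergent_tshift m x : convergent (fun i j => cf x i (m + j)).
Proof.
have /convergentP[M [K [M0 K0 xM]]] := cvalP x.
apply/convergentP; exists (M * K ^+ m), K.
split; rewrite ?mulr_gt0 ?exprn_gt0// => i j.
by rewrite -mulrA -exprD addnCA; exact: xM.
Qed.
Definition tshift m x : O := Cps (convergent_tshift m x).

Lemma cf_tshift m x i j : cf (tshift m x) i j = cf x i (m + j). Proof. by []. Qed.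

Lemma tshiftK m x : (forall i j, (j < m)%N -> cf x i j = 0) -> x = tX m * tshift m x.
Proof.
move=> xm; apply: cpsP => i j; rewrite cf_tXM.
by case: leqP => mj; [rewrite cf_tshift subnKC|exact: xm].
Qed.

Lemma tshift_lead m x i j : lead x i (m + j) ->
  x = tX m * tshift m x /\ lead (tshift m x) i j.
Proof.
case=> xl xk xij; split; first by apply: tshiftK => k l lm; rewrite xl ?ltn_addr.
by split=> // k l lj; rewrite cf_tshift xl ?ltn_add2l.
Qed.

(** The lowest monomial of [y] is free of [t], so that of [u] must supply [t^m]; since [lead]
    compares exponents of [t] first, all of [u] is then divisible by [t^m]. *)
Lemma regular_dvd_tX m x y u d : lead y d 0 -> tX m * x = y * u ->
  exists v, u = tX m * v.
Proof.
move=> ly xyu; case: (eqVneq u 0) => [->|/lead_exists[i [j lu]]].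
  by exists 0; rewrite mulr0.
have lyu := lead_mul ly lu; rewrite -xyu in lyu.
have [a [b [a' [b' [lt lx _ jE]]]]] := lead_mul_inv lyu.
have [_ bm] := lead_uniq lt (lead_tX m); subst b; rewrite add0n in jE.
by exists (tshift m u); rewrite jE in lu; have [] := tshift_lead lu.
Qed.

Section Division.
Variables (y : O) (d : nat).
Hypothesis yd : lead y d 0.
Variable z : O.
Let c := cf y d 0.
Let c_neq0 : c != 0. Proof. by case: yd. Qed.

(** The coefficient of [s^(i+d) t^j] in [z = q * y + r], solved for the coefficient of [s^i t^j] in
    [q]. By regularity of [y], only entries [a < i] of the current row and rows [b < j] occur. Rows
    are indexed by the exponent of [t]. *)
Let inner (rows : nat -> nat -> C) j (u : nat -> C) i :=
  c^-1 * (cf z (i + d) j - \sum_(a < i) u a * cf y (i + d - a) 0 -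
    \sum_(b < j) \sum_(a < (i + d).+1) rows b a * cf y (i + d - a) (j - b)).

Let quo := srec (fun=> 0) (fun rows j => srec 0 (inner rows j)).

Let quoE i j : c * quo j i =
  cf z (i + d) j - \sum_(a < i) quo j a * cf y (i + d - a) 0 -
    \sum_(b < j) \sum_(a < (i + d).+1) quo b a * cf y (i + d - a) (j - b).
Proof.
have innerE rows j' : forall i, srec 0 (inner rows j') i =
    inner rows j' (srec 0 (inner rows j')) i.
  apply: srecE => u v n uv; rewrite /inner; congr (_ * (_ - _ - _)).
  by apply: eq_bigr => a _; rewrite uv.
have -> : quo j = srec 0 (inner quo j).
  apply: srecE => u v n uv; congr srec; apply/funext => w; apply/funext => k.
  rewrite /inner; congr (_ * (_ - _)); apply: eq_bigr => b _.
  by apply: eq_bigr => a _; rewrite uv.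
by rewrite innerE mulVKf.
Qed.

Let convergent_quo : convergent (fun i j => quo j i).
Proof.
have [M [K [M0 K0 yM zM]]] := convergent_common (cvalP y) (cvalP z).
have c0 : 0 < `|c| by rewrite normr_gt0.
(* The ratios [X] and [Y] of the majorant [B X^i Y^j] are taken so large that
   each of the two sums of [quoE] is at most [|c| B X^i Y^j / 4]. *)
pose P := 2 + 8 * M * K ^+ d / `|c|; pose X := K * P.
have P2 : 2 <= P by rewrite lerDl !mulr_ge0 ?invr_ge0 ?exprn_ge0 ?ltW.
have P0 : 0 < P by apply: lt_le_trans P2.
have X0 : 0 < X by rewrite mulr_gt0.
pose Q := 2 + 16 * M * X ^+ d / `|c|; pose Y := K * Q.
have Q2 : 2 <= Q by rewrite lerDl !mulr_ge0 ?invr_ge0 ?exprn_ge0 ?ltW.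
have Q0 : 0 < Q by apply: lt_le_trans Q2.
have Y0 : 0 < Y by rewrite mulr_gt0.
(* This [B] bounds the contribution of [z] by half of [|c| B X^i Y^j], leaving a quarter for each
   sum. *)
pose B := 2 * M * K ^+ d / `|c|.
have B0 : 0 < B by rewrite !mulr_gt0 ?invr_gt0 ?exprn_gt0.
suff qB j i : `|quo j i| <= B * (X ^+ i * Y ^+ j).
  apply/convergentP; exists B, (X + Y); split; rewrite ?addr_gt0// => i j.
  apply: le_trans (qB j i) _; rewrite ler_pM2l// exprD.
  apply: ler_pM; rewrite ?exprn_ge0 ?(ltW X0) ?(ltW Y0)//.
    by rewrite lerXn2r ?nnegrE ?addr_ge0 ?(ltW X0) ?(ltW Y0)// lerDl ltW.
  by rewrite lerXn2r ?nnegrE ?addr_ge0 ?(ltW X0) ?(ltW Y0)// lerDr ltW.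
elim/ltn_ind: j i => j IHj i; elim/ltn_ind: i => i IHi.
rewrite -(ler_pM2l c0) -normrM quoE.
pose T : C := X ^+ i * Y ^+ j.
have T0 : 0 < T by rewrite mulr_gt0 ?exprn_gt0.
have K_le (Z : C) : 2 <= Z -> forall n, K ^+ n <= (K * Z) ^+ n.
  move=> Z2 n; have Z1 : 1 <= Z by apply: le_trans Z2; rewrite ler1n.
  rewrite lerXn2r ?nnegrE ?mulr_ge0 ?(ltW K0) ?(le_trans ler01 Z1)//.
  by rewrite ler_peMr// ltW.
have t1 : `|cf z (i + d) j| <= `|c| * B * T / 2.
  apply: le_trans (zM _ _) _.
  have -> : `|c| * B * T / 2 = M * K ^+ d * T.
    by rewrite /B; field; rewrite gt_eqF.
  rewrite -mulrA (ler_pM2l M0) !exprD [_ ^+ i * _]mulrC -mulrA ler_pM2l ?exprn_gt0//.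
  by apply: ler_pM; rewrite ?exprn_ge0 ?(ltW K0)// K_le.
have t2 : `|\sum_(a < i) quo j a * cf y (i + d - a) 0| <= `|c| * B * T / 4.
  apply: (@le_trans _ _ (\sum_(a < i) B * M * K ^+ d * Y ^+ j *
                           ((K * P) ^+ a * K ^+ (i - a)))).
    apply: le_trans (ler_norm_sum _ _ _) _; apply: ler_sum => a _.
    have ai := ltn_ord a.
    rewrite normrM.
    have := ler_pM (normr_ge0 _) (normr_ge0 _) (IHi _ ai) (yM (i + d - a)%N 0%N).
    rewrite addn0 -addnBAC ?(ltnW ai)// exprD => /le_trans-> //.
    by rewrite le_eqVlt; apply/orP; left; apply/eqP; rewrite -/X; ring.
  rewrite -mulr_sumr.
  apply: (@le_trans _ _ (B * M * K ^+ d * Y ^+ j * (2 / P * (K * P) ^+ i))).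
    apply: ler_wpM2l; last exact: geometric_sum_lt.
    exact: mulr_ge0 (mulr_ge0 (mulr_ge0 (ltW B0) (ltW M0))
      (exprn_ge0 _ (ltW K0))) (exprn_ge0 _ (ltW Y0)).
  have -> : B * M * K ^+ d * Y ^+ j * (2 / P * (K * P) ^+ i) =
            B * T * (8 * M * K ^+ d) / (4 * P).
    by rewrite /T -/X; field; rewrite gt_eqF.
  have -> : `|c| * B * T / 4 = B * T * (`|c| * P) / (4 * P).
    by field; rewrite gt_eqF.
  rewrite ler_pM2r; last by rewrite invr_gt0 pmulr_rgt0.
  rewrite (ler_pM2l (mulr_gt0 B0 T0)).
  have -> : `|c| * P = 2 * `|c| + 8 * M * K ^+ d.
    by rewrite /P; field; rewrite gt_eqF.
  by rewrite lerDr mulr_ge0// ltW.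
have t3 : `|\sum_(b < j) \sum_(a < (i + d).+1)
            quo b a * cf y (i + d - a) (j - b)| <= `|c| * B * T / 4.
  apply: (@le_trans _ _ (\sum_(b < j) \sum_(a < (i + d).+1) B * M *
           ((K * P) ^+ a * K ^+ (i + d - a)) * ((K * Q) ^+ b * K ^+ (j - b)))).
    apply: le_trans (ler_norm_sum _ _ _) _; apply: ler_sum => b _.
    apply: le_trans (ler_norm_sum _ _ _) _; apply: ler_sum => a _.
    rewrite normrM.
    have := ler_pM (normr_ge0 _) (normr_ge0 _)
      (IHj _ (ltn_ord b) a) (yM (i + d - a)%N (j - b)%N).
    rewrite exprD => /le_trans-> //.
    by rewrite le_eqVlt; apply/orP; left; apply/eqP; rewrite -/X -/Y; ring.
  have -> : \sum_(b < j) \sum_(a < (i + d).+1) B * M *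
      ((K * P) ^+ a * K ^+ (i + d - a)) * ((K * Q) ^+ b * K ^+ (j - b)) =
    B * M * (\sum_(a < (i + d).+1) (K * P) ^+ a * K ^+ (i + d - a)) *
      (\sum_(b < j) (K * Q) ^+ b * K ^+ (j - b)).
    rewrite mulr_sumr; apply: eq_bigr => b _.
    by rewrite mulr_sumr mulr_suml.
  apply: (@le_trans _ _ (B * M * (2 * (K * P) ^+ (i + d)) * (2 / Q * (K * Q) ^+ j))).
    have S0 (Z : C) n m : 2 <= Z -> 0 <= \sum_(a < m) (K * Z) ^+ a * K ^+ (n - a).
      move=> Z2; apply: sumr_ge0 => a _.
      by rewrite mulr_ge0 ?exprn_ge0 ?mulr_ge0 ?(ltW K0) ?(le_trans _ Z2).
    have BM : 0 < B * M by exact: mulr_gt0.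
    apply: ler_pM.
    - exact: mulr_ge0 (ltW BM) (S0 _ _ _ P2).
    - exact: S0.
    - by rewrite (ler_pM2l BM); exact: geometric_sum_le.
    - exact: geometric_sum_lt.
  have -> : B * M * (2 * (K * P) ^+ (i + d)) * (2 / Q * (K * Q) ^+ j) =
            B * T * (16 * M * X ^+ d) / (4 * Q).
    by rewrite /T -/X -/Y exprD; field; rewrite gt_eqF.
  have -> : `|c| * B * T / 4 = B * T * (`|c| * Q) / (4 * Q).
    by field; rewrite gt_eqF.
  rewrite ler_pM2r; last by rewrite invr_gt0 pmulr_rgt0.
  rewrite (ler_pM2l (mulr_gt0 B0 T0)).
  have -> : `|c| * Q = 2 * `|c| + 16 * M * X ^+ d.
    by rewrite /Q; field; rewrite gt_eqF.
  by rewrite lerDr mulr_ge0// ltW.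
rewrite -/T; have -> : `|c| * (B * T) =
    `|c| * B * T / 2 + `|c| * B * T / 4 + `|c| * B * T / 4.
  by field.
apply: le_trans (ler_normB _ _) _; apply: lerD t3.
by apply: le_trans (ler_normB _ _) _; apply: lerD t1 t2.
Qed.

(** With the remainder defined as a difference, [quoE] says exactly that its coefficients from [s^d]
    on vanish. *)
Lemma weierstrass_division : exists q r : O,
  z = q * y + r /\ forall i j, (d <= i)%N -> cf r i j = 0.
Proof.
exists (Cps convergent_quo), (z - Cps convergent_quo * y).
split=> [|i j di]; first by rewrite addrC subrK.
rewrite -(subnK di); set k := (i - d)%N.
rewrite cfB cfM exchange_big big_ord_recr /=.
have -> : \sum_(a < (k + d).+1)
      cf (Cps convergent_quo) a j * cf y (k + d - a) (j - j) =
          c * quo j k + \sum_(a < k) quo j a * cf y (k + d - a) 0.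
  rewrite subnn -(big_mkord xpredT (fun a => quo j a * cf y (k + d - a) 0)).
  rewrite (big_cat_nat (n := k.+1)) ?ltnS ?leq_addr//=.
  rewrite [X in _ + X = _]big1_seq ?addr0 => [|a /andP[_]].
    by rewrite big_nat_recr//= big_mkord addKn addrC [quo _ _ * _]mulrC.
  rewrite mem_index_iota => /andP[ka ad]; case: yd => _ yk _.
  by rewrite yk ?mulr0//; lia.
rewrite quoE.
have -> : \sum_(b < j) \sum_(a < (k + d).+1)
    cf (Cps convergent_quo) a b * cf y (k + d - a) (j - b) =
  \sum_(b < j) \sum_(a < (k + d).+1) quo b a * cf y (k + d - a) (j - b) by [].
by ring.
Qed.

End Division.

(** A nonzero [q] would give [q * y] a lowest monomial with exponent of [s] at least [d], where [r]
    has no terms. *)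
Lemma weierstrass_unique y d q r : lead y d 0 -> q * y + r = 0 ->
  (forall i j, (d <= i)%N -> cf r i j = 0) -> q = 0.
Proof.
move=> ly qyr r0; apply/eqP; apply: contraT => /lead_exists[i [j lq]].
have [_ _ /eqP[]] := lead_mul lq ly.
have -> : q * y = - r by apply/eqP; rewrite -addr_eq0 qyr.
by rewrite cfN r0 ?oppr0// leq_addl.
Qed.

End Weierstrass.

(** * Common factors and colength of a pair of germs *)

Section LinearAlgebra.

Lemma exists_kernel_vector (F : fieldType) m n (A : 'M[F]_(m, n)) : (n < m)%N ->
  exists2 v : 'rV_m, v != 0 & v *m A = 0.
Proof.
move=> nm; have : kermx A != 0.
  by rewrite kermx_eq0 /row_free neq_ltn (leq_ltn_trans (rank_leq_col A)).
by move=> /rowV0Pn[v /sub_kermxP vA v0]; exists v.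
Qed.

(* The relation is the expansion of the vanishing minor bordered by row [i]
   and any column, along that column. *)
Lemma bordered_minor_relation (A : comNzRingType) m n k (M : 'M[A]_(m, n))
    (S : 'I_k -> 'I_m) (S' : 'I_k -> 'I_n) :
  (forall (U : 'I_k.+1 -> 'I_m) (U' : 'I_k.+1 -> 'I_n), \det (mxsub U U' M) = 0) ->
  forall i, exists c : 'rV_k,
    \det (mxsub S S' M) *: row i M = c *m rowsub S M.
Proof.
move=> minor0 i.
pose U (l : 'I_k.+1) := if unlift ord_max l is Some l' then S l' else i.
pose U' j (l : 'I_k.+1) := if unlift ord_max l is Some l' then S' l' else j.
have Umax : U ord_max = i by rewrite /U unlift_none.
have Ulift l : U (lift ord_max l) = S l by rewrite /U liftK.
have U'max j : U' j ord_max = j by rewrite /U' unlift_none.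
have U'lift j l : U' j (lift ord_max l) = S' l by rewrite /U' liftK.
(* Deleting the last column removes the only dependence on [j], so the same cofactors serve for all
   columns. *)
pose cof (l : 'I_k.+1) : A := (-1) ^+ (l + k) *
  \det (mxsub (fun a => U (lift l a)) S' M).
have cofE j l : cofactor (mxsub U (U' j) M) l ord_max = cof l.
  rewrite /cofactor /cof; congr (_ * \det _); apply/matrixP => a b.
  by rewrite !mxE U'lift.
exists (\row_l - cof (lift ord_max l)); apply/rowP => j.
have := minor0 U (U' j); rewrite (expand_det_col _ ord_max).
under eq_bigr do rewrite cofE mxE U'max.
rewrite (bigD1_ord ord_max)//= Umax.
have -> : cof ord_max = \det (mxsub S S' M).
  rewrite /cof addnn -mul2n exprM sqrrN expr1n expr1n mul1r; congr (\det _).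
  by apply/matrixP => a b; rewrite !mxE Ulift.
move/eqP; rewrite addr_eq0 => /eqP detE; rewrite !mxE mulrC detE -sumrN.
by apply: eq_bigr => l _; rewrite !mxE Ulift mulNr mulrC.
Qed.

End LinearAlgebra.

Section Ideals.
Variable R : realType.
Local Notation C := (R[i]).
Local Notation O := (cps R).
Implicit Types (f g h x y z u v w F G : O).

Definition in_ideal f g x := exists a b, x = a * f + b * g.

Lemma in_idealD f g x y : in_ideal f g x -> in_ideal f g y -> in_ideal f g (x + y).
Proof. by move=> [a [b ->]] [a' [b' ->]]; exists (a + a'), (b + b'); ring. Qed.

Lemma in_idealM f g a x : in_ideal f g x -> in_ideal f g (a * x).
Proof. by move=> [b [c ->]]; exists (a * b), (a * c); ring. Qed.

Lemma in_ideall f g a : in_ideal f g (a * f).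
Proof. by exists a, 0; ring. Qed.

Lemma in_ideal_sum f g I (r : seq I) (P : pred I) (X : I -> O) :
  (forall i, in_ideal f g (X i)) -> in_ideal f g (\sum_(i <- r | P i) X i).
Proof.
move=> HX; elim/big_ind: _ => [|x y|//]; first by exists 0, 0; ring.
exact: in_idealD.
Qed.

Definition cps_unit z := exists w, z * w = 1.
Definition cps_dvd x y := exists c, y = x * c.
Definition cps_irreducible q :=
  [/\ q <> 0, ~ cps_unit q & forall b c, q = b * c -> cps_unit b \/ cps_unit c].

Lemma cps_dvd_trans x y z : cps_dvd x y -> cps_dvd y z -> cps_dvd x z.
Proof. by move=> [a ->] [b ->]; exists (a * b); ring. Qed.

(** Weierstrass division of [1] by a germ regular of order zero leaves no remainder. *)
Lemma cf00_unit z : cf z 0 0 != 0 -> cps_unit z.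
Proof.
move=> z0; have lz : lead z 0 0 by split.
have [q [r [qr r0]]] := weierstrass_division lz 1.
exists q; rewrite qr mulrC [X in _ + X](_ : r = 0) ?addr0//.
by apply: cpsP => i j; rewrite r0.
Qed.

Lemma irreducible_tX1 : cps_irreducible (tX R 1).
Proof.
split=> [|[w /(congr1 (fun z => cf z 0 0))]|b c tbc].
- by apply/eqP; exact: tX_neq0.
- by rewrite cf_tXM cf1 => /esym/eqP; rewrite oner_eq0.
case: (eqVneq (cf b 0 0) 0) => [b0|/cf00_unit]; last by left.
case: (eqVneq (cf c 0 0) 0) => [c0|/cf00_unit]; last by right.
have /eqP := congr1 (fun z => cf z 0 1) tbc.
by rewrite cf_mono cfM !(big_ord_recr, big_ord0)/= b0 c0 !(mul0r, mulr0, add0r) oner_eq0.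
Qed.

(** Induction on the order of regularity: it is additive on products and positive on regular
    nonunits. *)
Lemma exists_irreducible_factor z a : lead z a 0 -> ~ cps_unit z ->
  exists2 q, cps_irreducible q & cps_dvd q z.
Proof.
elim/ltn_ind: a z => a IH z lz nz.
have [zirr|] := EM (cps_irreducible z); first by exists z => //; exists 1; rewrite mulr1.
case/not_and3P => [| |].
- by move/contrapT => z0; have := lead_neq0 lz; rewrite z0 eqxx.
- by move/contrapT.
move=> /existsNP[b] /existsNP[c] /not_implyP[zbc] /not_orP[nb nc].
rewrite zbc in lz; have [k [l [lb lc akl]]] := regular_mul_inv lz.
have k0 : (0 < k)%N.
  by rewrite lt0n; apply/eqP => k0; apply: nb; apply: cf00_unit; subst k; case: lb.
have l0 : (0 < l)%N.
  by rewrite lt0n; apply/eqP => l0; apply: nc; apply: cf00_unit; subst l; case: lc.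
have [|q qirr qb] := IH k _ _ lb nb; first by lia.
by exists q => //; apply: cps_dvd_trans qb _; exists c.
Qed.

(** Take a regular [y] in [J] of least order [k]. A nonzero remainder modulo [y] lies in [J];
    stripped of its power of [t] it stays in [J] by saturation and is regular of order below [k],
    which is impossible. *)
Lemma saturated_ideal_principal (J : O -> Prop) y0 d :
  (forall x y, J x -> J y -> J (x + y)) -> (forall a x, J x -> J (a * x)) ->
  (forall m x, J (tX R m * x) -> J x) -> J y0 -> lead y0 d 0 ->
  exists y k, [/\ lead y k 0, J y & forall z, J z -> cps_dvd y z].
Proof.
move=> JD JM Jt Jy0 ly0.
have ex : exists k, `[< exists2 y, J y & lead y k 0 >].
  by exists d; apply/asboolP; exists y0.
case: (ex_minnP ex) => k /asboolP[y Jy ly] kmin; exists y, k; split=> // z Jz.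
have [q [r [zqr r0]]] := weierstrass_division ly z.
have rE : r = z + (- q) * y by rewrite zqr; ring.
have Jr : J r by rewrite rE; apply: JD => //; exact: JM.
have [r_0|] := eqVneq r 0; first by exists q; rewrite zqr r_0 addr0 mulrC.
move=> /lead_exists[i [j lr]].
have ik : (i < k)%N by rewrite ltnNge; apply/negP => ki; case: lr => _ _; rewrite r0 ?eqxx.
have [rt lt] : r = tX R j * tshift j r /\ lead (tshift j r) i 0.
  by apply: tshift_lead; rewrite addn0.
suff /kmin : `[< exists2 y, J y & lead y i 0 >] by rewrite leqNgt ik.
by apply/asboolP; exists (tshift j r) => //; apply: (Jt j); rewrite -rt.
Qed.

(* [h] generates the [t]-saturation of [(F, G)]. *)
Lemma regular_gcd F G d : lead F d 0 ->
  exists h f1 g1 m, [/\ F = h * f1, G = h * g1 & in_ideal f1 g1 (tX R m)].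
Proof.
move=> lF; pose J x := exists m, in_ideal F G (tX R m * x).
have [||||h [k [lh [m [a [b hab]]] hmin]]] :=
  @saturated_ideal_principal J F d _ _ _ _ lF.
- move=> x y [m xm] [n ym]; exists (m + n)%N; rewrite tXD.
  have -> : tX R m * tX R n * (x + y) =
    tX R n * (tX R m * x) + tX R m * (tX R n * y) by ring.
  by apply: in_idealD; exact: in_idealM.
- by move=> a x [m xm]; exists m; rewrite mulrCA; exact: in_idealM.
- by move=> m x [n xn]; exists (n + m)%N; rewrite tXD -mulrA.
- by exists 0%N, 1, 0; rewrite tX0; ring.
have [|f1 Ff1] := hmin F; first by exists 0%N, 1, 0; rewrite tX0; ring.
have [|g1 Gg1] := hmin G; first by exists 0%N, 0, 1; rewrite tX0; ring.
(* As [h] lies in the saturation, [t^m h] is in [(F, G)]; cancelling [h] gives the relation for [f1]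
   and [g1]. *)
exists h, f1, g1, m; split=> //; exists a, b.
apply: (cps_mulfI (lead_neq0 lh)); rewrite mulrC hab {1}Ff1 {1}Gg1; ring.
Qed.

(** The common divisor [h] from [regular_gcd] is regular, so if it were not a unit it would have an
    irreducible factor common to [F] and [G]. *)
Lemma coprime_tX F G d : lead F d 0 ->
  (forall q, cps_irreducible q -> cps_dvd q F -> ~ cps_dvd q G) ->
  exists m, in_ideal F G (tX R m).
Proof.
move=> lF cop; have [h [f1 [g1 [m [Fh Gh fg]]]]] := regular_gcd G lF.
have [a [b [lh _ _]]] : exists a b, [/\ lead h a 0, lead f1 b 0 & d = (a + b)%N].
  by apply: regular_mul_inv; rewrite -Fh.
have [[w hw]|nh] := EM (cps_unit h); last first.
  have [q qirr qh] := exists_irreducible_factor lh nh.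
  case: (cop q qirr); apply: cps_dvd_trans qh _; first by exists f1.
  by exists g1.
exists m; case: fg => x [y ->]; exists (x * w), (y * w).
by rewrite Fh Gh; transitivity ((h * w) * (x * f1 + y * g1)); [rewrite hw mul1r|ring].
Qed.

Section Colength.
Variables (F FL GL f g hf hg : O) (k d r : nat).
Hypotheses (FLE : FL = hf * f) (GLE : GL = hg * g) (FLF : FL = tX R k * F).
Hypotheses (lF : lead F d 0) (GL0 : GL != 0).
Hypothesis f_cop : forall q, cps_irreducible q -> cps_dvd q f -> ~ cps_dvd q GL.
Hypothesis g_cop : forall q, cps_irreducible q -> cps_dvd q g -> ~ cps_dvd q FL.
Hypothesis kG : k = 0%N \/ cps_dvd (tX R 1) GL.

(** If [k] is not zero then [t] divides [GL], so [f] is prime to [t], that is, regular in [s]; the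
    factor [t^k] of [hf * f] must therefore sit in [hf]. *)
Let f_dvd_F : cps_dvd f F.
Proof.
case: kG => [k0|tG]; first by exists hf; rewrite mulrC -FLE FLF k0 tX0 mul1r.
have f0 : f != 0.
  apply/eqP => f0; have := lead_neq0 (lead_mul (lead_tX R k) lF).
  by rewrite -FLF FLE f0 mulr0 eqxx.
have [i [[|j] lf]] := lead_exists f0.
  have fhf : tX R k * F = f * hf by rewrite -FLF FLE mulrC.
  have [v hv] := regular_dvd_tX lf fhf; exists v.
  by apply: (cps_mulfI (tX_neq0 R k)); rewrite fhf hv; ring.
case: (f_cop (irreducible_tX1)) => //.
have [ft _] : f = tX R 1 * tshift 1 f /\ lead (tshift 1 f) i j.
  exact: tshift_lead.
by exists (tshift 1 f).
Qed.

Let exists_reduction : exists h f1 g1 m, [/\ F = h * f1, GL = h * g1,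
  in_ideal f1 g1 (tX R m), cps_dvd f f1 & cps_dvd g g1].
Proof.
have [h [f1 [g1 [m [Fh Gh fg]]]]] := regular_gcd GL lF.
exists h, f1, g1, m; split=> //.
  (* From [t^n = x f + y GL] and [GL f1 = g1 F] it follows that [f] divides [t^n f1]; as [f] is
     regular, it divides [f1]. *)
  have [u Fu] := f_dvd_F.
  have [a [_ [lf _ _]]] : exists a b, [/\ lead f a 0, lead u b 0 & d = (a + b)%N].
    by apply: regular_mul_inv; rewrite -Fu.
  have [n [x [y xy]]] := coprime_tX lf f_cop.
  have [|v f1v] := regular_dvd_tX (m := n) (x := f1) (u := x * f1 + y * g1 * u) lf.
    transitivity (x * f * f1 + y * g1 * F); last by rewrite Fu; ring.
    by rewrite xy Gh Fh; ring.
  exists v; apply: (cps_mulfI (tX_neq0 R n)).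
  transitivity (f * (x * f1 + y * g1 * u)); last by rewrite f1v; ring.
  transitivity (x * f * f1 + y * g1 * F); last by rewrite Fu; ring.
  by rewrite xy Gh Fh; ring.
have [n [x [y xy]]] : exists n, in_ideal F g (tX R n).
  apply: coprime_tX lF _ => q qirr qF qg; apply: (g_cop qirr qg).
  by apply: cps_dvd_trans qF _; exists (tX R k); rewrite FLF mulrC.
have [a [_ [lh _ _]]] : exists a b, [/\ lead h a 0, lead f1 b 0 & d = (a + b)%N].
  by apply: regular_mul_inv; rewrite -Fh.
have g0 : g != 0 by apply/eqP => g0; move: GL0; rewrite GLE g0 mulr0 eqxx.
(* The germ [g] may be divisible by [t], so [t^n] has to be extracted from [u] instead:
   [t^n hg = h u] after cancelling [g], and [h] is regular. *)
pose u := x * f1 * hg + y * g1.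
have g1u : tX R n * g1 = g * u.
  transitivity (x * f1 * GL + y * g * g1); last by rewrite GLE /u; ring.
  by rewrite xy Gh Fh; ring.
have [|v uv] := regular_dvd_tX (m := n) (x := hg) (u := u) lh.
  apply: (cps_mulfI g0); transitivity (tX R n * GL); first by rewrite GLE; ring.
  by rewrite Gh mulrCA g1u; ring.
by exists v; apply: (cps_mulfI (tX_neq0 R n)); rewrite g1u uv; ring.
Qed.

Hypothesis torsion : forall v m,
  in_ideal F GL (tX R m * v) -> in_ideal F GL (tX R r * v).

(** Modulo [(F, GL)] the germs [h * X k] are torsion. Reduced by [F] they have degree below [d] in
    [s], so some combination has no terms of exponent below [r] in [t]. It is [t^r] times a torsion
    class, hence zero; cancelling [h] lands in [(f1, g1)], which is contained in [(f, g)]. *)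
Lemma split_colength_le N (X : 'I_N.+1 -> O) : (d * r <= N)%N ->
  exists c : 'I_N.+1 -> C, (exists k, c k != 0) /\
    in_ideal f g (\sum_k mono (c k) 0 0 * X k).
Proof.
move=> drN; have [h [f1 [g1 [m [Fh Gh fg [f' f1E] [g' g1E]]]]]] := exists_reduction.
have h0 : h != 0 by apply/eqP => h0; move: GL0; rewrite Gh h0 mul0r eqxx.
have [q /choice[/= rho hX]] := choice (fun k => weierstrass_division lF (h * X k)).
(* Column [l] encodes the monomial with exponents [l %/ r] in [s] and [l %% r] in [t]. *)
pose A : 'M[C]_(N.+1, d * r) := \matrix_(k, l) cf (rho k) (l %/ r) (l %% r).
have [c c0 cA] := exists_kernel_vector A drN.
exists (c 0); split.
  by have /rV0Pn[l cl] := c0; exists l.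
pose w := \sum_k mono (c 0 k) 0 0 * rho k.
pose Q := \sum_k mono (c 0 k) 0 0 * q k.
set Y := \sum_k _.
have hY : h * Y = Q * F + w.
  rewrite /Y /Q /w mulr_sumr mulr_suml -big_split /=; apply: eq_bigr => l _.
  by rewrite mulrCA (hX l).1; ring.
have wt : w = tX R r * tshift r w.
  apply: tshiftK => i j jr; rewrite cf_sum.
  case: (leqP d i) => di.
    by apply: big1 => l _; rewrite cf_monoM /= subn0 (hX l).2 ?mulr0.
  have l_lt : (i * r + j < d * r)%N by nia.
  have := congr1 (fun B : 'rV__ => B 0 (Ordinal l_lt)) cA; rewrite !mxE => cA0.
  rewrite -[RHS]cA0; apply: eq_bigr => l _.
  rewrite cf_monoM /= !subn0 mxE /= divnMDl ?divn_small ?addn0 ?modnMDl ?modn_small//.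
  by lia.
have hYI : in_ideal F GL (h * Y).
  rewrite hY wt; apply: in_idealD; first exact: in_ideall.
  apply: (torsion (m := (m + r)%N)); rewrite tXD -mulrA -wt.
  have -> : tX R m * w = tX R m * (h * Y) + (- (tX R m * Q)) * F by rewrite hY; ring.
  apply: in_idealD; last exact: in_ideall.
  have [a [b ->]] := fg; exists (a * Y), (b * Y).
  by rewrite Fh Gh; ring.
have [a [b hab]] := hYI; exists (a * f'), (b * g').
apply: (cps_mulfI h0); rewrite hab {1}Fh {1}Gh f1E g1E; ring.
Qed.

End Colength.
End Ideals.

(** * Torsion of [O/(F, G)] over [C{t}] *)

Section Torsion.
Variable R : realType.
Local Notation C := (R[i]).
Local Notation O := (cps R).

(* [T] stands for the subring [C{t}]. *)
Definition inT (z : O) := forall k l, (0 < k)%N -> cf z k l = 0.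

Lemma inT1 : inT 1.
Proof. by move=> k l k0; rewrite cf1 gtn_eqF. Qed.
Lemma inT_tX m : inT (tX R m).
Proof. by move=> k l k0; rewrite cf_mono gtn_eqF. Qed.
Lemma inTN x : inT x -> inT (- x).
Proof. by move=> xT k l k0; rewrite cfN xT ?oppr0. Qed.
Lemma inTD x y : inT x -> inT y -> inT (x + y).
Proof. by move=> xT yT k l k0; rewrite cfD xT ?yT ?addr0. Qed.
Lemma inTM x y : inT x -> inT y -> inT (x * y).
Proof.
move=> xT yT k l k0; rewrite cfM; apply: big1 => a _; apply: big1 => b _.
case: (posnP a) => [->|a0]; last by rewrite xT ?mul0r.
by rewrite yT ?mulr0// subn0.
Qed.
Lemma inT_sum I (r : seq I) (P : pred I) (X : I -> O) :
  (forall i, inT (X i)) -> inT (\sum_(i <- r | P i) X i).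
Proof. by move=> XT; elim/big_ind: _ => //; exact: inTD. Qed.
Lemma inT_det n (M : 'M[O]_n) : (forall i j, inT (M i j)) -> inT (\det M).
Proof.
move=> MT; apply: inT_sum => s; apply: inTM.
  elim: (nat_of_bool _) => [|e IH]; first exact: inT1.
  by rewrite exprS; apply: inTM => //; apply: inTN; exact: inT1.
by elim/big_ind: _ => [|x y|i _]; [exact: inT1|exact: inTM|].
Qed.

Lemma convergent_slice (z : O) i :
  convergent (fun k l => if (k == 0)%N then cf z i l else 0).
Proof.
have /convergentP[M [K [M0 K0 zM]]] := cvalP z.
apply/convergentP; exists (M * K ^+ i), K; split; rewrite ?mulr_gt0 ?exprn_gt0//.
case=> [|k] l /=; last by rewrite normr0 !mulr_ge0 ?exprn_ge0 ?ltW.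
by rewrite -mulrA -exprD; exact: zM.
Qed.
Definition slice z i : O := Cps (convergent_slice z i).

Lemma inT_slice z i : inT (slice z i).
Proof. by case. Qed.

Section Coordinates.
Variable d : nat.

Definition combo (V : 'rV[O]_d) : O := \sum_j V 0 j * mono 1 j 0.

Lemma cf_combo (V : 'rV[O]_d) (i : 'I_d) l : (forall j, inT (V 0 j)) ->
  cf (combo V) i l = cf (V 0 i) 0 l.
Proof.
move=> VT; rewrite cf_sum (bigD1 i)// [V 0 i * _]mulrC cf_monoM leqnn /= subnn subn0 mul1r.
rewrite big1 ?addr0// => j /eqP ji; rewrite mulrC cf_monoM /= andbT mul1r.
by case: leqP => // jli; rewrite VT// subn_gt0 ltn_neqAle jli andbT; apply/eqP => /val_inj.
Qed.

Lemma cf_combo_ge (V : 'rV[O]_d) i l : (forall j, inT (V 0 j)) -> (d <= i)%N ->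
  cf (combo V) i l = 0.
Proof.
move=> VT di; rewrite cf_sum big1// => j _; rewrite mulrC cf_monoM /= andbT.
have ji : (j < i)%N by apply: leq_trans di.
by rewrite ltnW// VT ?mulr0// subn_gt0.
Qed.

Lemma comboD V W : combo (V + W) = combo V + combo W.
Proof. by rewrite -big_split; apply: eq_bigr => j _; rewrite mxE mulrDl. Qed.

Lemma comboZ a V : combo (a *: V) = a * combo V.
Proof. by rewrite mulr_sumr; apply: eq_bigr => j _; rewrite mxE mulrA. Qed.

Lemma combo_mulmx n (V : 'rV_n) (M : 'M_(n, d)) :
  combo (V *m M) = \sum_i V 0 i * combo (row i M).
Proof.
under [RHS]eq_bigr do rewrite mulr_sumr.
rewrite exchange_big; apply: eq_bigr => j _; rewrite mxE mulr_suml.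
by apply: eq_bigr => i _; rewrite mxE mulrA.
Qed.

Variable F : O.
Hypothesis lF : lead F d 0.

Lemma coordinates v : exists (V : 'rV[O]_d) q,
  (forall j, inT (V 0 j)) /\ v = q * F + combo V.
Proof.
have [q [r [-> r0]]] := weierstrass_division lF v.
pose V := \row_(j < d) slice r j.
have VT j : inT (V 0 j) by rewrite mxE; exact: inT_slice.
exists V, q; split=> //; congr (_ + _); apply: cpsP => i l.
case: (ltnP i d) => id; last by rewrite r0// cf_combo_ge.
by rewrite (cf_combo (Ordinal id))// mxE.
Qed.

(** With [coordinates], this is the freeness of [O/(F)] over [C{t}]; the difference of two
    coordinate vectors gives a Weierstrass remainder of zero. *)
Lemma coordinates_uniq (V W : 'rV[O]_d) q : (forall j, inT (V 0 j)) ->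
  (forall j, inT (W 0 j)) -> combo V = q * F + combo W -> V = W.
Proof.
move=> VT WT VW; have VWT j : inT ((V + - 1 *: W) 0 j).
  by rewrite !mxE mulN1r; apply: inTD => //; exact: inTN.
have qVW : (- q) * F + combo (V + - 1 *: W) = 0.
  by rewrite comboD comboZ VW; ring.
have q0 : - q = 0.
  by apply: weierstrass_unique lF qVW _ => i j; exact: cf_combo_ge.
rewrite q0 mul0r add0r in qVW.
apply/rowP => j; apply: cpsP => k l.
case: (posnP k) => [->|k0]; last by rewrite VT ?WT.
have := cf_combo j l VWT; rewrite qVW !mxE cfD mulN1r cfN => /esym/eqP.
by rewrite subr_eq0 => /eqP.
Qed.

Variables (G : O) (M : 'M[O]_d).
Hypothesis MT : forall i j, inT (M i j).
Hypothesis MG : forall i : 'I_d, exists q, mono 1 i 0 * G = q * F + combo (row i M).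

Lemma combo_mul_ideal (V : 'rV[O]_d) : exists q, combo V * G = q * F + combo (V *m M).
Proof.
have [q qE] := choice MG.
exists (\sum_i V 0 i * q i); rewrite combo_mulmx !mulr_suml -big_split /=.
by apply: eq_bigr => i _; rewrite -mulrA qE; ring.
Qed.

(* With [delta = t^r * unit] the nonzero minor, Cramer's rule shows that
   [delta] kills the torsion of [O / (F, G)] over [C{t}]. *)
Lemma torsion_exponent k (S S' : 'I_k -> 'I_d) r :
  (forall U U' : 'I_k.+1 -> 'I_d, \det (mxsub U U' M) = 0) ->
  cf (\det (mxsub S S' M)) 0 r != 0 ->
  forall v m, in_ideal F G (tX R m * v) -> in_ideal F G (tX R r * v).
Proof.
move=> minor0; set delta := \det _ => deltar v m [a [b vab]].
have deltaT : inT delta by apply: inT_det => i j; rewrite mxE.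
have delta0 : delta != 0 by apply: contraNneq deltar => ->; rewrite cf0.
(* The series [delta] is a unit times [t^j] with [j <= r], so killing by [delta] implies killing by
   [t^r]. *)
suff [x [y xy]] : in_ideal F G (delta * v).
  have [i [j ld]] := lead_exists delta0.
  have i0 : i = 0%N.
    by case: ld => _ _; case: (posnP i) => // i0; rewrite deltaT ?eqxx.
  subst i; have jr : (j <= r)%N.
    by rewrite leqNgt; apply/negP => rj; case: ld => l0 _ _; rewrite l0 ?eqxx in deltar.
  have [dt [_ _ /cf00_unit[w uw]]] :
      delta = tX R j * tshift j delta /\ lead (tshift j delta) 0 0.
    by apply: tshift_lead; rewrite addn0.
  have -> : tX R r * v = tX R (r - j)%N * w * (delta * v).
    rewrite -{1}(subnK jr) tXD dt.
    transitivity ((tshift j delta * w) * (tX R (r - j)%N * tX R j * v)); last by ring.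
    by rewrite uw mul1r.
  by apply: in_idealM; exists x, y.
have [V [q [VT vV]]] := coordinates v.
have [B [q' [BT bB]]] := coordinates b.
have [p pE] := combo_mul_ideal B.
have BMT j : inT ((B *m M) 0 j).
  by rewrite mxE; apply: inT_sum => i; exact: inTM.
(* This is [t^m v = a F + b G] read in coordinates modulo [F]. *)
have tV : tX R m *: V = B *m M.
  apply: (@coordinates_uniq _ _ (a + q' * G + p - tX R m * q)) => // [j|].
    by rewrite mxE; apply: inTM => //; exact: inT_tX.
  have : tX R m * (q * F + combo V) = a * F + (q' * F + combo B) * G.
    by rewrite -vV vab -bB.
  rewrite comboZ mulrDr [(_ + combo B) * G]mulrDl pE => /(canRL (addKr _)) ->.
  by ring.
have [c cE] := choice (bordered_minor_relation S S' minor0).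
pose W : 'rV[O]_k := \sum_i B 0 i *: c i.
have dBM : delta *: (B *m M) = W *m rowsub S M.
  rewrite mulmx_sum_row scaler_sumr mulmx_suml; apply: eq_bigr => i _.
  by rewrite -scalemxAl -cE !scalerA mulrC.
(* Restricted to the columns [S'], [dBM] is a square system for [W]. The adjugate solves it up to
   [delta], which shows [W] divisible by [t^m]; then [t^m] can be cancelled from [dBM] itself. *)
pose tau := colsub S' V *m \adj (mxsub S S' M).
have Wtau : W = tX R m *: tau.
  have : delta *: W = delta *: (tX R m *: tau).
    have -> : delta *: W = W *m mxsub S S' M *m \adj (mxsub S S' M).
      by rewrite -mulmxA mul_mx_adj mul_mx_scalar.
    have -> : W *m mxsub S S' M = colsub S' (W *m rowsub S M).
      by apply/rowP => j; rewrite !mxE; apply: eq_bigr => l _; rewrite !mxE.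
    rewrite -dBM -tV !linearZ /= -!scalemxAl scalerA -/tau.
    by rewrite [RHS]scalerA mulrC.
  move/rowP => e; apply/rowP => j; apply: (cps_mulfI delta0).
  by have := e j; rewrite !mxE.
have dV : delta *: V = tau *m rowsub S M.
  have e : delta *: (tX R m *: V) = tX R m *: (tau *m rowsub S M).
    by rewrite tV dBM Wtau -scalemxAl.
  apply/rowP => j; apply: (cps_mulfI (tX_neq0 R m)).
  by have /rowP/(_ j) := e; rewrite !mxE => <-; ring.
rewrite vV mulrDr -comboZ dV combo_mulmx; apply: in_idealD.
  by rewrite mulrA; exact: in_ideall.
apply: in_ideal_sum => i; apply: in_idealM.
have [q1 q1E] := MG (S i).
have -> : combo (row i (rowsub S M)) = combo (row (S i) M).
  by apply: eq_bigr => j _; rewrite !mxE.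
have -> : combo (row (S i) M) = (- q1) * F + mono 1 (S i) 0 * G by rewrite q1E; ring.
by exists (- q1), (mono 1 (S i) 0).
Qed.

End Coordinates.
End Torsion.

(** * Noetherian rings and generic algebras of functions *)

Section Noetherian.

(** The ascending chain condition in sequential form: no sequence keeps leaving the ideal generated
    by its earlier terms. *)
Definition noetherian (A : comNzRingType) := forall u : nat -> A,
  exists n (c : nat -> A), u n = \sum_(i < n) c i * u i.

Lemma noetherian_field (F : fieldType) : noetherian F.
Proof.
move=> u; have [u0|u0] := eqVneq (u 0%N) 0.
  by exists 0%N, (fun=> 0); rewrite big_ord0.
by exists 1%N, (fun=> u 1%N / u 0%N); rewrite big_ord1 divfK.
Qed.

Section HilbertBasis.
Variable A : comNzRingType.
Implicit Types (p q : {poly A}) (s : seq {poly A}) (f : nat -> {poly A}).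

Let span s p := exists c : nat -> {poly A}, p = \sum_(i < size s) c i * s`_i.

Let span_mem s i : (i < size s)%N -> span s s`_i.
Proof.
move=> iS; exists (fun j => (j == i)%:R).
rewrite (bigD1 (Ordinal iS))//= eqxx mul1r big1 ?addr0// => j.
by rewrite -val_eqE /= => /negbTE->; rewrite mul0r.
Qed.

Let spanD s p q : span s p -> span s q -> span s (p + q).
Proof.
move=> [c ->] [c' ->]; exists (fun i => c i + c' i).
by rewrite -big_split; apply: eq_bigr => i _; rewrite mulrDl.
Qed.

Let spanM s p q : span s q -> span s (p * q).
Proof.
move=> [c ->]; exists (fun i => p * c i).
by rewrite mulr_sumr; apply: eq_bigr => i _; rewrite mulrA.
Qed.

Let span_sum s n (F : 'I_n -> {poly A}) :
  (forall i, span s (F i)) -> span s (\sum_i F i).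
Proof.
move=> sF; elim/big_ind: _ => //; last exact: spanD.
by exists (fun=> 0); rewrite big1// => i _; rewrite mul0r.
Qed.

Let span_le s s' p : (forall i, (i < size s)%N -> span s' s`_i) ->
  span s p -> span s' p.
Proof. by move=> ss' [c ->]; apply: span_sum => i; apply: spanM; exact: ss'. Qed.

Let span_mkseq f m n p : (m <= n)%N -> span (mkseq f m) p -> span (mkseq f n) p.
Proof.
move=> mn; apply: span_le => i; rewrite size_mkseq => im.
have im' := leq_trans im mn.
by rewrite nth_mkseq// -(nth_mkseq 0 f im'); apply: span_mem; rewrite size_mkseq.
Qed.

(** In the ideal [I] of a bad sequence, choose each [f n] of least size outside the span of its
    predecessors. A relation between leading coefficients gives a combination [h] of predecessors
    with the leading term of [f n], and [f n - h] is smaller but still outside the span. *)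
Theorem hilbert_basis : noetherian A -> noetherian {poly A}.
Proof.
move=> nA u; apply: contrapT => bad.
have u_new n : ~ span (mkseq u n) (u n).
  move=> [c uc]; apply: bad; exists n, c; rewrite uc size_mkseq.
  by apply: eq_bigr => i _; rewrite nth_mkseq.
pose I p := exists n, span (mkseq u n) p.
have I_u n : I (u n).
  exists n.+1; rewrite -[u n](nth_mkseq 0 u (ltnSn n)).
  by apply: span_mem; rewrite size_mkseq.
have ID p q : I p -> I q -> I (p + q).
  move=> [m pm] [n qn]; exists (maxn m n); apply: spanD.
    exact: span_mkseq (leq_maxl _ _) pm.
  exact: span_mkseq (leq_maxr _ _) qn.
have IM p q : I q -> I (p * q) by move=> [m qm]; exists m; exact: spanM.
(* Stated for every list, with membership in [I] as an inner premise, so that choice yields a total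
   function. *)
have next s : exists p, (forall i, (i < size s)%N -> I s`_i) ->
    [/\ I p, ~ span s p & forall q, I q -> ~ span s q -> (size p <= size q)%N].
  have [sI|] := EM (forall i, (i < size s)%N -> I s`_i); last by exists 0.
  have [m sm] : exists m, forall i, (i < size s)%N -> span (mkseq u m) s`_i.
    elim: s sI => [|p s IH] sI; first by exists 0%N.
    have [|m sm] := IH; first by move=> i; exact: (sI i.+1).
    have [n pn] := sI 0%N isT; exists (maxn m n); case=> [_|i /sm].
      exact: span_mkseq (leq_maxr _ _) pn.
    exact: span_mkseq (leq_maxl _ _).
  have ex : exists k, `[< exists p, [/\ I p, ~ span s p & size p = k] >].
    exists (size (u m)); apply/asboolP; exists (u m); split=> // su.
    by apply: (u_new m); exact: span_le su.
  case: (ex_minnP ex) => k /asboolP[p [Ip sp pk]] kmin.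
  exists p => _; split=> // q Iq sq; rewrite pk; apply: kmin.
  by apply/asboolP; exists q.
have [nxt nxtP] := choice next.
pose f := srec (0 : {poly A}) (fun f n => nxt (mkseq f n)).
have fE n : f n = nxt (mkseq f n).
  apply: srecE => v w k vw; congr nxt.
  by apply/eq_in_map => i; rewrite mem_iota => /vw.
have fI n : I (f n).
  elim/ltn_ind: n => n IH; rewrite fE; case: (nxtP (mkseq f n)) => // i.
  by rewrite size_mkseq => i_n; rewrite nth_mkseq//; exact: IH.
have fP n : ~ span (mkseq f n) (f n) /\
    forall q, I q -> ~ span (mkseq f n) q -> (size (f n) <= size q)%N.
  case: (nxtP (mkseq f n)) => [i|_]; last by rewrite -fE.
  by rewrite size_mkseq => i_n; rewrite nth_mkseq.
have f_size i n : (i <= n)%N -> (size (f i) <= size (f n))%N.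
  move=> i_n; apply: (fP i).2 => // /(span_mkseq i_n); exact: (fP n).1.
have f_neq0 n : f n != 0.
  apply/eqP => f0; apply: (fP n).1; rewrite f0; exists (fun=> 0).
  by rewrite big1// => i _; rewrite mul0r.
have [n [c nc]] := nA (fun n => lead_coef (f n)).
pose h := \sum_(i < n) (c i)%:P * ('X^(size (f n) - size (f i)) * f i).
have hs : span (mkseq f n) h.
  apply: span_sum => i; apply: spanM; apply: spanM.
  by rewrite -(nth_mkseq 0 f (ltn_ord i)); apply: span_mem; rewrite size_mkseq.
have hI : I h.
  rewrite /h; elim/big_ind: _ => [|//|i _]; last exact/IM/IM.
  by exists 0%N, (fun=> 0); rewrite big_ord0.
have hn j : ((size (f n)).-1 <= j)%N -> h`_j = (f n)`_j.
  have fn0 : (0 < size (f n))%N by rewrite size_poly_gt0.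
  rewrite leq_eqVlt prednK// => /orP[/eqP<-|nj]; last first.
    rewrite [RHS]nth_default// coef_sum big1// => i _.
    rewrite coefCM coefXnM ifN ?nth_default ?mulr0 -?leqNgt//.
      apply: leq_trans (leq_sub2r _ nj).
      by rewrite subKn//; exact/f_size/ltnW.
    by apply: leq_trans nj; exact: leq_subr.
  rewrite [RHS]nc coef_sum; apply: eq_bigr => i _.
  have fi0 : (0 < size (f i))%N by rewrite size_poly_gt0.
  have fin := f_size i n (ltnW (ltn_ord i)).
  rewrite coefCM coefXnM ifN -?leqNgt; last by rewrite -subn1 leq_sub2l.
  by rewrite -subn1 subnAC subKn// subn1.
have size_ge : (size (f n) <= size (f n - h)%R)%N.
  apply: (fP n).2 => [|fh]; first by rewrite -mulN1r; apply: ID => //; exact: IM.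
  by apply: (fP n).1; rewrite -(subrK h (f n)); exact: spanD.
have size_le : (size (f n - h)%R <= (size (f n)).-1)%N.
  by apply/leq_sizeP => j /hn hj; rewrite coefB hj subrr.
have := leq_trans size_ge size_le.
by have := f_neq0 n; rewrite -size_poly_gt0; case: (size _) => // ?; rewrite ltnn.
Qed.

End HilbertBasis.

(** [A] is the polynomial ring in [k] variables, built one variable at a time, and [ev N] evaluates
    the variables at the [a i N]. *)
Lemma noetherian_generated (F : fieldType) k (a : nat -> nat -> F) :
  exists (A : comNzRingType) (ev : nat -> {rmorphism A -> F}),
    [/\ noetherian A, forall c, exists x, forall N, ev N x = c &
        forall i, (i < k)%N -> exists x, forall N, ev N x = a i N].
Proof.
elim: k => [|k [A [ev [nA Ac Aa]]]].
  exists F, (fun=> (idfun : {rmorphism F -> F})); split=> // [|c].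
    exact: noetherian_field.
  by exists c.
exists {poly A}, (fun N =>
  (horner_eval (a k N) \o map_poly (ev N) : {rmorphism {poly A} -> F})).
split=> [|c|i].
- exact: hilbert_basis.
- by have [x xc] := Ac c; exists x%:P => N;
    rewrite /= map_polyC /horner_eval hornerC; exact: xc.
- rewrite ltnS leq_eqVlt => /orP[/eqP->|/Aa[x xa]].
    by exists 'X => N; rewrite /= map_polyX /horner_eval hornerX.
  by exists x%:P => N; rewrite /= map_polyC /horner_eval hornerC; exact: xa.
Qed.

End Noetherian.

Section Families.
Variable F : fieldType.
Implicit Types (E : nat -> Prop) (D : (nat -> F) -> Prop) (a b c : nat -> F).

Definition unbounded E := forall N0, exists N, (N0 <= N)%N /\ E N.

(* An algebra [D] of functions on the index set [E] that behaves like a domain: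
   a function that is not identically zero has only finitely many zeros. *)
Record generic_algebra E D : Prop := GenericAlgebra {
  ga_unbounded : unbounded E;
  ga_const : forall c : F, D (fun=> c);
  ga_add : forall a b, D a -> D b -> D (fun N => a N + b N);
  ga_mul : forall a b, D a -> D b -> D (fun N => a N * b N);
  ga_ext : forall a b, D a -> (forall N, E N -> a N = b N) -> D b;
  ga_zeros : forall a, D a -> (forall N, E N -> a N = 0) \/
    exists N0, forall N, E N -> (N0 <= N)%N -> a N != 0 }.

(** Otherwise each unbounded set has an element of [A] vanishing on an unbounded part of it but not
    on all of it. Passing repeatedly to that part gives a sequence whose every term is nonzero at an
    index where all earlier terms vanish, against [noetherian]. *)
Lemma noetherian_generic (A : comNzRingType) (ev : nat -> {rmorphism A -> F}) :
  noetherian A -> exists E, unbounded E /\ forall x,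
    (forall N, E N -> ev N x = 0) \/
    exists N0, forall N, E N -> (N0 <= N)%N -> ev N x != 0.
Proof.
move=> nA; apply: contrapT => bad.
have split_ E : exists x, unbounded E -> (exists N, E N /\ ev N x <> 0) /\
    unbounded (fun N => E N /\ ev N x = 0).
  apply: contrapT => /forallNP h; apply: bad; exists E; split=> [|x].
    by apply: contrapT => Eb; apply: (h 0).
  apply: contrapT => /not_orP[nz nf]; apply: (h x) => _; split.
    move: nz => /existsNP[N /not_implyP[EN xN]]; by exists N.
  move=> N0; apply: contrapT => /forallNP no; apply: nf; exists N0 => N EN N0N.
  by apply/eqP => xN; apply: (no N).
have [pick pickP] := choice split_.
pose E_ := fix E_ k := if k is k'.+1 then
  fun N => E_ k' N /\ ev N (pick (E_ k')) = 0 else fun=> True.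
have E_unb k : unbounded (E_ k).
  elim: k => [N0|k IH]; first by exists N0.
  exact: (pickP _ IH).2.
have [n [c nc]] := nA (fun k => pick (E_ k)).
have [[N [EN xN]] _] := pickP _ (E_unb n); apply: xN; rewrite nc rmorph_sum big1// => i _.
suff H m : E_ m N -> (i < m)%N -> ev N (pick (E_ i)) = 0.
  by rewrite rmorphM (H n)// mulr0.
elim: m => // m IH [Em xm]; rewrite ltnS leq_eqVlt => /orP[/eqP->//|]; exact: IH.
Qed.

Lemma generic_algebra_exists k (a : nat -> nat -> F) :
  exists E D, generic_algebra E D /\ forall i, (i < k)%N -> D (a i).
Proof.
have [A [ev [nA Ac Aa]]] := noetherian_generated k a.
have [E [Eunb Ez]] := noetherian_generic ev nA.
exists E, (fun b => exists x, forall N, E N -> b N = ev N x); split; last first.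
  by move=> i /Aa[x xa]; exists x => N _; rewrite xa.
split=> //.
- by move=> c; have [x xc] := Ac c; exists x => N _; rewrite xc.
- by move=> b b' [x xb] [x' xb']; exists (x + x') => N EN; rewrite rmorphD xb ?xb'.
- by move=> b b' [x xb] [x' xb']; exists (x * x') => N EN; rewrite rmorphM xb ?xb'.
- by move=> b b' [x xb] bb'; exists x => N EN; rewrite -bb' ?xb.
- move=> b [x xb]; case: (Ez x) => [x0|[N0 x0]]; [left|right; exists N0].
    by move=> N EN; rewrite xb ?x0.
  by move=> N EN N0N; rewrite xb ?x0.
Qed.

Lemma ga_exp E D a n : generic_algebra E D -> D a -> D (fun N => a N ^+ n).
Proof.
move=> gD Da; elim: n => [|n IH]; first exact: (ga_const gD 1).
apply: (ga_ext gD (ga_mul gD Da IH)) => N _; by rewrite exprS.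
Qed.

Lemma ga_sum E D I (r : seq I) (P : pred I) (a : I -> nat -> F) :
  generic_algebra E D -> (forall i, P i -> D (a i)) ->
  D (fun N => \sum_(i <- r | P i) a i N).
Proof.
move=> gD Da; elim: r => [|i r IH].
  by apply: (ga_ext gD (ga_const gD 0)) => N _; rewrite big_nil.
case: (boolP (P i)) => Pi.
  apply: (ga_ext gD (ga_add gD (Da i Pi) IH)) => N _; by rewrite big_cons Pi.
by apply: (ga_ext gD IH) => N _; rewrite big_cons (negbTE Pi).
Qed.

(** [D'] consists of the fractions with a power of [c] as denominator, and [E'] drops the zeros of
    [c], which are bounded. *)
Lemma generic_localization E D c : generic_algebra E D -> D c ->
  ~ (forall N, E N -> c N = 0) ->
  exists E' D', [/\ generic_algebra E' D', forall N, E' N -> E N /\ c N != 0,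
    forall a, D a -> D' a & D' (fun N => (c N)^-1)].
Proof.
move=> gD Dc cn0; pose E' N := E N /\ c N != 0.
exists E', (fun a => exists k b, D b /\ forall N, E' N -> a N * c N ^+ k = b N).
split=> //.
- split.
  + have [c0|[N1 c0]] := ga_zeros gD Dc; first by case: cn0.
    move=> N0; have [N [NN EN]] := ga_unbounded gD (maxn N0 N1).
    move: NN; rewrite geq_max => /andP[N0N N1N].
    by exists N; split=> //; split=> //; exact: c0.
  + move=> x; exists 0%N, (fun=> x); split=> [|N _]; last by rewrite mulr1.
    exact: (ga_const gD x).
  + move=> a b [k [a' [Da' aE]]] [l [b' [Db' bE]]].
    exists (k + l)%N, (fun N => a' N * c N ^+ l + b' N * c N ^+ k).
    split=> [|N EN].
      by apply: (ga_add gD); apply: (ga_mul gD) => //; exact: (ga_exp _ gD).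
    by rewrite -aE// -bE// exprD; ring.
  + move=> a b [k [a' [Da' aE]]] [l [b' [Db' bE]]].
    exists (k + l)%N, (fun N => a' N * b' N).
    split=> [|N EN]; first exact: (ga_mul gD).
    by rewrite -aE// -bE// exprD; ring.
  + move=> a b [k [a' [Da' aE]]] ab; exists k, a'; split=> // N EN.
    by rewrite -ab ?aE.
  + move=> a [k [a' [Da' aE]]]; case: (ga_zeros gD Da') => [a0|[N0 a0]].
      left=> N EN; have /eqP := aE N EN; rewrite (a0 N EN.1) mulf_eq0.
      by rewrite expf_eq0 (negbTE EN.2) andbF orbF => /eqP.
    right; exists N0 => N EN N0N; have := a0 N EN.1 N0N; rewrite -aE//.
    by apply: contraNneq => ->; rewrite mul0r.
- move=> a Da; exists 0%N, a; split=> // N _; by rewrite mulr1.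
- exists 1%N, (fun=> 1); split=> [|N [_ c0]]; first exact: (ga_const gD 1).
  by rewrite expr1 mulVf.
Qed.

End Families.

(** * Families of pairs of germs *)

Section PowerSeriesFamilies.
Variable R : realType.
Local Notation C := (R[i]).
Local Notation O := (cps R).
Variables (E : nat -> Prop) (D : (nat -> C) -> Prop).
Hypothesis gD : generic_algebra E D.

Definition coef_family (x : nat -> O) := forall i j, D (fun N => cf (x N) i j).

Lemma family_const z : coef_family (fun=> z).
Proof. by move=> i j; exact: (ga_const gD). Qed.

Lemma family_ext x y : coef_family x -> (forall N, E N -> x N = y N) -> coef_family y.
Proof. by move=> Dx xy i j; apply: (ga_ext gD (Dx i j)) => N EN; rewrite xy. Qed.

Lemma familyD x y : coef_family x -> coef_family y -> coef_family (fun N => x N + y N).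
Proof. by move=> Dx Dy i j; exact: (ga_add gD (Dx i j) (Dy i j)). Qed.

Lemma familyM x y : coef_family x -> coef_family y -> coef_family (fun N => x N * y N).
Proof.
move=> Dx Dy i j; apply: (ga_ext gD (a := fun N =>
  \sum_(k < i.+1) \sum_(l < j.+1) cf (x N) k l * cf (y N) (i - k) (j - l))).
  apply: (ga_sum _ gD) => k _; apply: (ga_sum _ gD) => l _.
  exact: (ga_mul gD (Dx k l) (Dy _ _)).
by move=> N _; rewrite cfM.
Qed.

Lemma family_sum I (r : seq I) (P : pred I) (x : I -> nat -> O) :
  (forall i, coef_family (x i)) -> coef_family (fun N => \sum_(i <- r | P i) x i N).
Proof.
move=> Dx; elim: r => [|i r IH].
  by apply: family_ext (family_const 0) _ => N _; rewrite big_nil.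
case: (boolP (P i)) => Pi.
  by apply: family_ext (familyD (Dx i) IH) _ => N _; rewrite big_cons Pi.
by apply: family_ext IH _ => N _; rewrite big_cons (negbTE Pi).
Qed.

Lemma family_prod I (r : seq I) (P : pred I) (x : I -> nat -> O) :
  (forall i, coef_family (x i)) -> coef_family (fun N => \prod_(i <- r | P i) x i N).
Proof.
move=> Dx; elim: r => [|i r IH].
  by apply: family_ext (family_const 1) _ => N _; rewrite big_nil.
case: (boolP (P i)) => Pi.
  by apply: family_ext (familyM (Dx i) IH) _ => N _; rewrite big_cons Pi.
by apply: family_ext IH _ => N _; rewrite big_cons (negbTE Pi).
Qed.

Lemma family_det n (M : nat -> 'M[O]_n) :
  (forall i j, coef_family (fun N => M N i j)) -> coef_family (fun N => \det (M N)).
Proof.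
move=> DM; apply: family_sum => s; apply: familyM; first exact: family_const.
exact: family_prod.
Qed.

(** The recursion of Weierstrass division is polynomial in the coefficients of [y] and [z] and the
    inverse of the leading coefficient of [y]. *)
Lemma division_family d (y z q r : nat -> O) :
  coef_family y -> coef_family z -> D (fun N => (cf (y N) d 0)^-1) ->
  (forall N, E N -> [/\ lead (y N) d 0, z N = q N * y N + r N &
    forall i j, (d <= i)%N -> cf (r N) i j = 0]) ->
  coef_family r.
Proof.
move=> Dy Dz Dc zE.
have Dq : forall j i, D (fun N => cf (q N) i j).
  elim/ltn_ind => j IHj; elim/ltn_ind => i IHi.
  apply: (ga_ext gD (a := fun N => (cf (y N) d 0)^-1 * (cf (z N) (i + d) j +
    (-1) * (\sum_(a < i) cf (q N) a j * cf (y N) (i + d - a) 0 +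
      \sum_(b < j) \sum_(a < (i + d).+1) cf (q N) a b * cf (y N) (i + d - a) (j - b))))).
    apply: (ga_mul gD Dc); apply: (ga_add gD); first exact: Dz.
    apply: (ga_mul gD); first exact: (ga_const gD).
    apply: (ga_add gD).
      apply: (ga_sum _ gD) => a _.
      by apply: (ga_mul gD); [exact: IHi|exact: Dy].
    apply: (ga_sum _ gD) => b _; apply: (ga_sum _ gD) => a _.
    by apply: (ga_mul gD); [exact: IHj|exact: Dy].
  move=> N EN; have [[_ yk c0] -> r0] := zE N EN.
  rewrite cfD r0 ?leq_addl// addr0 cfM exchange_big big_ord_recr /= subnn.
  rewrite -(big_mkord xpredT (fun a => cf (q N) a j * cf (y N) (i + d - a) 0)).
  rewrite (big_cat_nat (n := i.+1)) ?ltnS ?leq_addr//=.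
  rewrite [X in _ + (_ + X) + _]big1_seq => [|a /andP[_]]; last first.
    by rewrite mem_index_iota => ad; rewrite yk ?mulr0//; lia.
  rewrite addr0 big_nat_recr//= big_mkord addKn; field; exact: c0.
move=> i j; apply: (ga_ext gD (a := fun N => cf (z N) i j + (-1) *
    \sum_(k < i.+1) \sum_(l < j.+1) cf (q N) k l * cf (y N) (i - k) (j - l))).
  apply: (ga_add gD); first exact: Dz.
  apply: (ga_mul gD); first exact: (ga_const gD).
  apply: (ga_sum _ gD) => k _; apply: (ga_sum _ gD) => l _.
  by apply: (ga_mul gD); [exact: Dq|exact: Dy].
move=> N EN; have [_ -> _] := zE N EN.
by rewrite cfD -cfM; ring.
Qed.

End PowerSeriesFamilies.

Section UniformBound.
Variable R : realType.
Local Notation C := (R[i]).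
Local Notation O := (cps R).

Definition gcd_free_parts (F G f g : O) := exists hf hg,
  [/\ F = hf * f, G = hg * g,
    forall q, cps_irreducible q -> cps_dvd q f -> ~ cps_dvd q G &
    forall q, cps_irreducible q -> cps_dvd q g -> ~ cps_dvd q F].

(** Here [k] is the generic rank. Some minor of size [k] is not identically zero on [E], so one of
    its coefficients in [t] is a nonzero function in [D], and that function vanishes at no large
    index of [E]. *)
Lemma generic_minors E (D : (nat -> C) -> Prop) d (M : nat -> 'M[O]_d) :
  generic_algebra E D ->
  (forall N i j, E N -> inT (M N i j)) ->
  (forall i j, coef_family D (fun N => M N i j)) ->
  exists k (S S' : 'I_k -> 'I_d) r N0, forall N, E N -> (N0 <= N)%N ->
    (forall U U' : 'I_k.+1 -> 'I_d, \det (mxsub U U' (M N)) = 0) /\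
    cf (\det (mxsub S S' (M N))) 0 r != 0.
Proof.
move=> gD MT DM.
pose P k := forall S S' : 'I_k -> 'I_d, forall N, E N -> \det (mxsub S S' (M N)) = 0.
have ex : exists k, `[< P k >].
  (* Selecting [d + 1] rows out of [d] repeats one. *)
  exists d.+1; apply/asboolP => S S' N _.
  have /injectivePn[i [j ij Sij]] : ~~ injectiveb S.
    apply/negP => /injectiveP/leq_card; rewrite !card_ord ltnn//.
  by apply: (determinant_alternate ij) => l; rewrite !mxE Sij.
(* The empty minor is [1], so the least size at which all minors vanish is a successor. *)
case: (ex_minnP ex) => -[|k] /asboolP Pk kmin.
  have [N [_ EN]] := ga_unbounded gD 0.
  pose S (i : 'I_0) : 'I_d := False_rect _ (notF (valP i)).
  by have /eqP := Pk S S N EN; rewrite det_mx00 oner_eq0.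
have /existsNP[S /existsNP[S' nP]] : ~ P k.
  by move=> Pk'; have := kmin k; rewrite (asboolT Pk') => /(_ isT); rewrite ltnn.
have [r nr] : exists r, ~ forall N, E N -> cf (\det (mxsub S S' (M N))) 0 r = 0.
  apply: contrapT => /forallNP all0; apply: nP => N EN; apply: cpsP => -[|i] j.
    by have /contrapT -> := all0 j.
  by apply: inT_det => // a b; rewrite mxE; exact: MT.
have Dminor : coef_family D (fun N => \det (mxsub S S' (M N))).
  apply: (family_det gD) => i j a b; apply: (ga_ext gD (DM (S i) (S' j) a b)) => N _.
  by rewrite mxE.
have [//|[N0 rN0]] := ga_zeros gD (Dminor 0%N r).
exists k, S, S', r, N0 => N EN N0N; split; last exact: rN0.
by move=> U U'; exact: Pk.
Qed.

(* The last hypothesis, which holds for [(F, G)] or for [(G, F)], makes [f N]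
   prime to the power of [t] that is split off from [F N]. *)
Lemma uniform_colength E (D : (nat -> C) -> Prop) (F G f g : nat -> O) :
  generic_algebra E D -> coef_family D F -> coef_family D G ->
  (forall N, E N -> [/\ F N != 0, G N != 0 & gcd_free_parts (F N) (G N) (f N) (g N)]) ->
  (exists i, ~ forall N, E N -> cf (F N) i 0 = 0) \/
    (forall i N, E N -> cf (G N) i 0 = 0) ->
  exists N, E N /\ forall X : 'I_N.+1 -> O, exists c : 'I_N.+1 -> C,
    (exists k, c k != 0) /\ in_ideal (f N) (g N) (\sum_k mono (c k) 0 0 * X k).
Proof.
move=> gD DF DG FG tFG.
pose Z i j := forall N, E N -> cf (F N) i j = 0.
have exj : exists j, `[< exists i, ~ Z i j >].
  have [N [_ EN]] := ga_unbounded gD 0.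
  have [/cps_neq0P[i [j Fij]] _ _] := FG N EN.
  exists j; apply/asboolP; exists i => /(_ N EN) Fij0.
  by rewrite Fij0 eqxx in Fij.
(* [t^k] is the largest power of [t] dividing the whole family, and [d] is least with the
   coefficient of [s^d t^k] not identically zero on [E]. *)
case: (ex_minnP exj) => k /asboolP exi kmin.
have exi' : exists i, `[< ~ Z i k >] by case: exi => i Zi; exists i; apply/asboolP.
case: (ex_minnP exi') => d /asboolP Zd dmin.
(* Away from the zeros of this coefficient, [F N] is [t^k] times a germ regular of the same order
   [d] for all [N]. *)
have [E' [D' [gD' EE' DD' Dc]]] := generic_localization gD (DF d k) Zd.
pose F' N := tshift k (F N).
have F0 N i j : E N -> (j < k)%N -> cf (F N) i j = 0.
  move=> EN jk; apply: contrapT => Fij; have := kmin j; rewrite asboolT.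
    by move=> /(_ isT); rewrite leqNgt jk.
  by exists i => /(_ N EN).
have F'P N : E' N -> F N = tX R k * F' N /\ lead (F' N) d 0.
  move=> /EE'[EN c0]; apply: tshift_lead; rewrite addn0; split=> //.
    by move=> i j; exact: F0.
  move=> i id; apply: contrapT => Fik; have := dmin i; rewrite asboolT.
    by move=> /(_ isT); rewrite leqNgt id.
  by move=> /(_ N EN).
have kG N : E' N -> k = 0%N \/ cps_dvd (tX R 1) (G N).
  move=> /EE'[EN _]; case: tFG => [[i Zi]|G0]; [left|right].
    by apply/eqP; rewrite -leqn0; apply: kmin; apply/asboolP; exists i.
  by exists (tshift 1 (G N)); apply: tshiftK => i [|//] _; exact: G0.
have exM N : exists M : 'M[O]_d, E' N -> (forall i j, inT (M i j)) /\
    forall i : 'I_d, exists q, mono 1 i 0 * G N = q * F' N + combo (row i M).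
  have [E'N|] := EM (E' N); last by exists 0.
  have [_ lF] := F'P N E'N.
  have [V VP] := choice (fun i : 'I_d => coordinates lF (mono 1 i 0 * G N)).
  exists (\matrix_i V i) => _; split=> [i j|i].
    by rewrite mxE; have [q [VT _]] := VP i.
  by rewrite rowK; have [q [_ qE]] := VP i; exists q.
have [M MP] := choice exM.
have DM i j : coef_family D' (fun N => M N i j).
  have exq N : exists q, E' N -> mono 1 i 0 * G N = q * F' N + combo (row i (M N)).
    have [E'N|] := EM (E' N); last by exists 0.
    by have [_ /(_ i)[q qE]] := MP N E'N; exists q.
  have [q qE] := choice exq.
  have rowT N : E' N -> forall j, inT (row i (M N) 0 j).
    by move=> /MP[MT _] l; rewrite mxE.
  (* Row [i] encodes the Weierstrass remainder of [s^i G] modulo [F']. *)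
  have Dr : coef_family D' (fun N => combo (row i (M N))).
    apply: (division_family gD' (d := d) (y := F') (q := q)
              (z := fun N => mono 1 i 0 * G N)).
    - by move=> a b; apply: DD'; exact: DF.
    - apply: (familyM gD'); first exact: (family_const gD').
      by move=> a b; apply: DD'; exact: DG.
    - by apply: (ga_ext gD' Dc) => N _; rewrite cf_tshift addn0.
    - move=> N E'N; have [_ lF] := F'P N E'N; split=> //; first exact: qE.
      by move=> a b; apply: cf_combo_ge; exact: rowT.
  move=> [|a] b; last first.
    apply: (ga_ext gD' (ga_const gD' 0)) => N E'N.
    by have [MT _] := MP N E'N; rewrite MT.
  apply: (ga_ext gD' (Dr j b)) => N E'N.
  by rewrite cf_combo ?mxE//; exact: rowT.
have [k' [S [S' [r [N0 minors]]]]] :=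
  generic_minors gD' (fun N i j E'N => (MP N E'N).1 i j) DM.
(* Neither [d] nor [r] depends on the index, so an index above [d * r] exists. *)
have [N [NN E'N]] := ga_unbounded gD' (maxn N0 (d * r)).
move: NN; rewrite geq_max => /andP[N0N drN].
exists N; split=> [|X]; first exact: (EE' N E'N).1.
have [EN _] := EE' N E'N.
have [Fk lF] := F'P N E'N; have [MT MG] := MP N E'N.
have [minor0 minor_neq0] := minors N E'N N0N.
have [_ GN0 [hf [hg [FE GE f_cop g_cop]]]] := FG N EN.
apply: (split_colength_le FE GE Fk lF GN0 f_cop g_cop (kG N E'N) _ X drN).
exact: (torsion_exponent lF MT MG minor0 minor_neq0).
Qed.

End UniformBound.

(** * Families of leaves *)

Section LeafFamilies.
Variable R : realType.
Local Notation C := (R[i]).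
Variables (E : nat -> Prop) (D : (nat -> C) -> Prop).
Hypothesis gD : generic_algebra E D.

(** Control is limited to bidegree [(i, j)] because the recursion along the leaf knows only those
    coefficients of [phi] at that stage. *)
Let family_upto i j (Q : nat -> {poly {poly C}}) :=
  forall i' j', (i' <= i)%N -> (j' <= j)%N -> D (fun N => (Q N)`_i'`_j').

Let family_uptoM i j P Q : family_upto i j P -> family_upto i j Q ->
  family_upto i j (fun N => P N * Q N).
Proof.
move=> DP DQ i' j' ii jj; apply: (ga_ext gD (a := fun N =>
  \sum_(k < i'.+1) \sum_(l < j'.+1) (P N)`_k`_l * (Q N)`_(i' - k)`_(j' - l))).
  apply: (ga_sum _ gD) => k _; apply: (ga_sum _ gD) => l _.
  have := ltn_ord k; have := ltn_ord l => lj ki.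
  by apply: (ga_mul gD); [apply: DP; lia|apply: DQ; lia].
move=> N _; rewrite coefM coef_sum; apply: eq_bigr => k _; by rewrite coefM.
Qed.

Let family_upto_const i j c : D c -> family_upto i j (fun N => (c N)%:P%:P).
Proof.
move=> Dc i' j' _ _; apply: (ga_ext gD (a := fun N =>
  if (i' == 0)%N && (j' == 0)%N then c N else 0)).
  by case: (_ && _); [exact: Dc|exact: (ga_const gD 0)].
by move=> N _; rewrite (coefC (c N)%:P); case: eqP => _ /=; rewrite ?coef0// coefC.
Qed.

Let family_upto_ext i j P Q :
  family_upto i j P -> (forall N, P N = Q N) -> family_upto i j Q.
Proof.
by move=> DP PQ i' j' ii jj; apply: (ga_ext gD (DP _ _ ii jj)) => N _; rewrite PQ.
Qed.

Let family_upto1 i j : family_upto i j (fun=> 1).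
Proof.
apply: (family_upto_ext (family_upto_const (c := fun=> 1) (ga_const gD 1))) => N.
by rewrite !polyC1.
Qed.

Let family_uptoX i j P e : family_upto i j P -> family_upto i j (fun N => P N ^+ e).
Proof.
move=> DP; elim: e => [|e IH]; first exact: family_upto1.
by apply: family_upto_ext (family_uptoM DP IH) _ => N; rewrite exprS.
Qed.

Let family_upto_prod i j I (r : seq I) (P : I -> nat -> {poly {poly C}}) :
  (forall k, family_upto i j (P k)) ->
  family_upto i j (fun N => \prod_(k <- r) P k N).
Proof.
move=> DP; elim: r => [|k r IH].
  by apply: family_upto_ext (@family_upto1 i j) _ => N; rewrite big_nil.
by apply: family_upto_ext (family_uptoM (DP k) IH) _ => N; rewrite big_cons.
Qed.

Variable n : nat.

Lemma pscomp_family (W : nat -> {mpoly C[n]}) (phi : nat -> 'I_n -> ps R) w i j :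
  (forall N, (msize (W N) <= w)%N) ->
  (forall m : 'X_{1..n < w}, D (fun N => (W N)@_m)) ->
  (forall k i' j', (i' <= i)%N -> (j' <= j)%N -> D (fun N => phi N k i' j')) ->
  D (fun N => pscomp (W N) (phi N) i j).
Proof.
move=> Ww DW Dphi.
pose T N (k : 'I_n) := trunc (i + j) (phi N k).
have WE N : pscomp (W N) (phi N) i j = \sum_(m : 'X_{1..n < w})
    (((W N)@_m)%:P%:P * mmap1 (T N) m)`_i`_j.
  rewrite /pscomp -[mmap _ _ _]/(mmap (polyC \o polyC) (T N) (W N)).
  by rewrite (mmapE _ (Ww N)) !coef_sum.
apply: (ga_ext gD _ (fun N _ => esym (WE N))).
apply: (ga_sum _ gD) => m _.
have DQ : family_upto i j (fun N => mmap1 (T N) m); last first.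
  exact: (family_uptoM (family_upto_const (DW m)) DQ (leqnn i) (leqnn j)).
apply: family_upto_prod => k; apply: family_uptoX => i' j' ii jj.
apply: (ga_ext gD (Dphi k i' j' ii jj)) => N _.
by rewrite /T /trunc !coef_poly ltnS (leq_trans ii) ?leq_addr// coef_poly ltnS
  (leq_trans jj) ?leq_addl.
Qed.

(** The flow of [V1] gives the coefficients with exponent [i + 1] in [s] from those with exponent at
    most [i]; on the line [s = 0] the flow of [V2] does the same in [t], starting from [p]. *)
Lemma leaf_family (V1 V2 : nat -> vfield R n) p (phi : nat -> 'I_n -> ps R) v1 v2 :
  (forall N, leaf_param (V1 N) (V2 N) (p N) (phi N)) ->
  (forall N k, (msize (V1 N k) <= v1)%N) -> (forall N k, (msize (V2 N k) <= v2)%N) ->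
  (forall k (m : 'X_{1..n < v1}), D (fun N => (V1 N k)@_m)) ->
  (forall k (m : 'X_{1..n < v2}), D (fun N => (V2 N k)@_m)) ->
  (forall k, D (fun N => p N k)) ->
  forall i j k, D (fun N => phi N k i j).
Proof.
move=> leaf V1v V2v DV1 DV2 Dp.
elim/ltn_ind => -[_|i IHi] j; last first.
  move=> k; apply: (ga_ext gD (a := fun N =>
    (i.+1%:R)^-1 * pscomp (V1 N k) (phi N) i j)).
    apply: (ga_mul gD); first exact: (ga_const gD).
    by apply: (pscomp_family (V1v^~ k) (DV1 k)) => l i' j' ii _; apply: IHi.
  move=> N _; have [_ _ <- _] := leaf N k.
  by rewrite /psds mulKf// pnatr_eq0.
elim/ltn_ind: j => -[_|j IHj] k.
  by apply: (ga_ext gD (Dp k)) => N _; have [_ -> _ _] := leaf N k.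
apply: (ga_ext gD (a := fun N => (j.+1%:R)^-1 * pscomp (V2 N k) (phi N) 0 j)).
  apply: (ga_mul gD); first exact: (ga_const gD).
  apply: (pscomp_family (V2v^~ k) (DV2 k)) => l i' j'.
  by rewrite leqn0 => /eqP-> jj; apply: IHj.
move=> N _; have [_ _ _ <-] := leaf N k.
by rewrite /psdt mulKf// pnatr_eq0.
Qed.

End LeafFamilies.

Lemma generic_algebra_exists_fin (F : fieldType) (I : finType) (a : I -> nat -> F) :
  exists E D, generic_algebra E D /\ forall i, D (a i).
Proof.
pose b k : nat -> F :=
  if insub k is Some o then a (enum_val (o : 'I_#|I|)) else fun=> 0.
have [E [D [gD Db]]] := generic_algebra_exists #|I| b.
exists E, D; split=> // i; have := Db _ (ltn_ord (enum_rank i)).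
by rewrite /b valK enum_rankK.
Qed.

(** * Translation between raw series and the bundled ring *)

Section Bridge.
Variable R : realType.
Local Notation O := (cps R).

Lemma cval_inj (x y : O) : cval x = cval y -> x = y.
Proof. by move=> xy; apply: cpsP => i j; rewrite /cf xy. Qed.

Lemma psdvdP (x y : O) : psdvd (cval x) (cval y) <-> cps_dvd x y.
Proof.
split=> [[c [cc xy]]|[c ->]]; first by exists (Cps cc); exact: cval_inj.
by exists (cval c); split=> //; exact: cvalP.
Qed.

Lemma psunitP (x : O) : psunit (cval x) <-> cps_unit x.
Proof.
split=> [[c [cc xy]]|[c xc]]; first by exists (Cps cc); apply: cval_inj.
by exists (cval c); split; [exact: cvalP|exact: (congr1 (@cval R) xc)].
Qed.

Lemma psirreducible_cps (q : O) : cps_irreducible q -> psirreducible (cval q).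
Proof.
case=> q0 nu qirr; split.
- exact: cvalP.
- by move=> q0'; apply: q0; exact: cval_inj.
- by rewrite psunitP.
- move=> b c cb cc qbc.
  have [|/psunitP|/psunitP] := qirr (Cps cb) (Cps cc); first exact: cval_inj.
    by left.
  by right.
Qed.

Lemma in_ideal2P (f g x : O) : in_ideal2 (cval f) (cval g) (cval x) <-> in_ideal f g x.
Proof.
split=> [[a [b [ca cb xE]]]|[a [b ->]]].
  by exists (Cps ca), (Cps cb); exact: cval_inj.
by exists (cval a), (cval b); split=> //; exact: cvalP.
Qed.

Lemma colength_le_cps (f g : O) N :
  (forall X : 'I_N.+1 -> O, exists c : 'I_N.+1 -> R[i], (exists k, c k != 0) /\
     in_ideal f g (\sum_k mono (c k) 0 0 * X k)) ->
  colength_le (cval f) (cval g) N.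
Proof.
move=> fgN x cx; have [c [c0 /in_ideal2P cI]] := fgN (fun k => Cps (cx k)).
exists c; split=> //; congr in_ideal2: cI.
apply/funext => i; apply/funext => j.
rewrite -[LHS]/(cf (\sum_k mono (c k) 0 0 * Cps (cx k)) i j) cf_sum.
by apply: eq_bigr => k _; rewrite cf_monoM /= !subn0.
Qed.

Lemma colength_leC (f g : ps R) N : colength_le f g N -> colength_le g f N.
Proof.
move=> fgN x cx; have [c [c0 [a [b [ca cb xE]]]]] := fgN x cx.
exists c; split=> //; exists b, a; split=> //; rewrite xE.
by apply/funext => i; apply/funext => j; exact: addrC.
Qed.

End Bridge.

(** * The bound, from a sequence of counterexamples *)

Record instance (R : realType) n := Instance {
  inst_V1 : vfield R n; inst_V2 : vfield R n;
  inst_F : {mpoly R[i][n]}; inst_G : {mpoly R[i][n]};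
  inst_p : 'I_n -> R[i]; inst_phi : 'I_n -> ps R;
  inst_hf : ps R; inst_f : ps R; inst_hg : ps R; inst_g : ps R }.

Lemma msize_le_mdegree (R : realType) n (P : {mpoly R[i][n]}) :
  (msize P <= (mdegree P).+1)%N.
Proof. exact: leqSpred. Qed.

Lemma bounded_colength (R : realType) (n v1 v2 df dg : nat) : exists B : nat,
  forall (V1 V2 : vfield R n) (F G : {mpoly R[i][n]}) (p : 'I_n -> R[i])
    (phi : 'I_n -> ps R) (hf f hg g : ps R),
    vdegree V1 = v1 -> vdegree V2 = v2 -> mdegree F = df -> mdegree G = dg ->
    leaf_param V1 V2 p phi -> pscomp F phi <> ps0 R -> pscomp G phi <> ps0 R ->
    common_factor_split (pscomp F phi) (pscomp G phi) hf f hg g ->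
    colength_le f g B.
Proof.
apply: contrapT => /forallNP bad.
(* The data [t N] violate the bound [N], so a single index [N] with colength at most [N] is a
   contradiction. *)
have {bad} /choice[t tP] : forall N, exists t : instance R n,
  [/\ [/\ vdegree (inst_V1 t) = v1, vdegree (inst_V2 t) = v2,
          mdegree (inst_F t) = df & mdegree (inst_G t) = dg],
      leaf_param (inst_V1 t) (inst_V2 t) (inst_p t) (inst_phi t),
      pscomp (inst_F t) (inst_phi t) <> ps0 R /\ pscomp (inst_G t) (inst_phi t) <> ps0 R,
      common_factor_split (pscomp (inst_F t) (inst_phi t))
        (pscomp (inst_G t) (inst_phi t))
        (inst_hf t) (inst_f t) (inst_hg t) (inst_g t) &
      ~ colength_le (inst_f t) (inst_g t) N].
  move=> N; apply: contrapT => /forallNP no; apply: (bad N).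
  move=> V1 V2 F G p phi hf f hg g dV1 dV2 dF dG leaf F0 G0 fs.
  apply: contrapT => nfg.
  by apply: (no (Instance V1 V2 F G p phi hf f hg g)); split.
(* The fixed degrees leave finitely many parameters, and these determine all Taylor coefficients of
   the leaf and of both restrictions. *)
pose I := ('I_n * 'X_{1..n < v1.+1} + 'I_n * 'X_{1..n < v2.+1} +
  ('X_{1..n < df.+1} + 'X_{1..n < dg.+1} + 'I_n))%type.
pose a (i : I) N : R[i] := match i with
  | inl (inl (k, m)) => (inst_V1 (t N) k)@_m
  | inl (inr (k, m)) => (inst_V2 (t N) k)@_m
  | inr (inl (inl m)) => (inst_F (t N))@_m
  | inr (inl (inr m)) => (inst_G (t N))@_m
  | inr (inr k) => inst_p (t N) k
  end.
have [E [D [gD Da]]] : exists E (D : (nat -> R[i]) -> Prop),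
  generic_algebra E D /\ forall i, D (a i) by exact: generic_algebra_exists_fin.
have Dphi : forall i j k, D (fun N => inst_phi (t N) k i j).
  apply: (leaf_family gD (p := fun N => inst_p (t N)) (V1 := fun N => inst_V1 (t N))
    (V2 := fun N => inst_V2 (t N)) (v1 := v1.+1) (v2 := v2.+1)).
  - by move=> N; have [] := tP N.
  - move=> N k; have [[<- _ _ _] _ _ _ _] := tP N.
    apply: leq_trans (msize_le_mdegree _) _; rewrite ltnS /vdegree.
    exact: (leq_bigmax k).
  - move=> N k; have [[_ <- _ _] _ _ _ _] := tP N.
    apply: leq_trans (msize_le_mdegree _) _; rewrite ltnS /vdegree.
    exact: (leq_bigmax k).
  - by move=> k m; exact: (Da (inl (inl (k, m)))).
  - by move=> k m; exact: (Da (inl (inr (k, m)))).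
  - by move=> k; exact: (Da (inr (inr k))).
have DpF i j : D (fun N => pscomp (inst_F (t N)) (inst_phi (t N)) i j).
  apply: (pscomp_family gD (w := df.+1)) => [N|m|k i' j' _ _] //.
    by have [[_ _ <- _] _ _ _ _] := tP N; exact: msize_le_mdegree.
  exact: (Da (inr (inl (inl m)))).
have DpG i j : D (fun N => pscomp (inst_G (t N)) (inst_phi (t N)) i j).
  apply: (pscomp_family gD (w := dg.+1)) => [N|m|k i' j' _ _] //.
    by have [[_ _ _ <-] _ _ _ _] := tP N; exact: msize_le_mdegree.
  exact: (Da (inr (inl (inr m)))).
have /choice[F FP] : forall N, exists z : cps R,
    cval z = pscomp (inst_F (t N)) (inst_phi (t N)).
  (* Convergence of the restriction is read off from its factorization. *)
  move=> N; have [_ _ _ [[chf cf] _ -> _ _] _] := tP N.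
  by exists (Cps chf * Cps cf).
have /choice[G GP] : forall N, exists z : cps R,
    cval z = pscomp (inst_G (t N)) (inst_phi (t N)).
  move=> N; have [_ _ _ [_ [chg cg] _ -> _] _] := tP N.
  by exists (Cps chg * Cps cg).
have DF : coef_family D F.
  by move=> i j; apply: (ga_ext gD (DpF i j)) => N _; rewrite /cf FP.
have DG : coef_family D G.
  by move=> i j; apply: (ga_ext gD (DpG i j)) => N _; rewrite /cf GP.
have /choice[f fP] : forall N, exists z : cps R, cval z = inst_f (t N).
  by move=> N; have [_ _ _ [[_ cf] _ _ _ _] _] := tP N; exists (Cps cf).
have /choice[g gP] : forall N, exists z : cps R, cval z = inst_g (t N).
  by move=> N; have [_ _ _ [_ [_ cg] _ _ _] _] := tP N; exists (Cps cg).
have F0 N : F N != 0.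
  apply/eqP => F0; have [_ _ [pF0 _] _ _] := tP N; apply: pF0; rewrite -FP F0.
  by [].
have G0 N : G N != 0.
  apply/eqP => G0; have [_ _ [_ pG0] _ _] := tP N; apply: pG0; rewrite -GP G0.
  by [].
have FGs N : gcd_free_parts (F N) (G N) (f N) (g N).
  have [_ _ _ [[chf _] [chg _] FE GE cop] _] := tP N.
  exists (Cps chf), (Cps chg); split.
  - by apply: cval_inj; rewrite FP FE -fP.
  - by apply: cval_inj; rewrite GP GE -gP.
  - move=> q /psirreducible_cps/cop[_ fG _ _] /psdvdP qf /psdvdP qG.
    by apply: fG; rewrite ?GP -?fP in qG *.
  - move=> q /psirreducible_cps/cop[_ _ _ gF] /psdvdP qg /psdvdP qF.
    by apply: gF; rewrite ?FP -?gP in qF *.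
have GFs N : gcd_free_parts (G N) (F N) (g N) (f N).
  by have [hf [hg [? ? ? ?]]] := FGs N; exists hg, hf; split.
(* If [t] divides every [F N] with [N] in [E], the two germs exchange roles: the power of [t] is
   split off from [G N], and [t] divides the other germ. *)
have [tF|tF] := EM (exists i, ~ forall N, E N -> cf (F N) i 0 = 0).
  have [N [_ /colength_le_cps]] : exists N, _ :=
    uniform_colength gD DF DG (fun N _ => And3 (F0 N) (G0 N) (FGs N)) (or_introl tF).
  by rewrite fP gP; have [] := tP N.
have tF0 : forall i N, E N -> cf (F N) i 0 = 0.
  by move=> i; apply: contrapT => nF; apply: tF; exists i.
have [N [_ /colength_le_cps/colength_leC]] : exists N, _ :=
  uniform_colength gD DG DF (fun N _ => And3 (G0 N) (F0 N) (GFs N)) (or_intror tF0).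
by rewrite fP gP; have [] := tP N.
Qed.

Theorem theorem4p1 (R : realType) :
  exists B : nat -> nat -> nat -> nat -> nat -> nat,
  forall (n : nat) (V1 V2 : vfield R n)
         (F G : {mpoly R[i][n]}) (p : 'I_n -> R[i]) (phi : 'I_n -> ps R)
         (hf f hg g : ps R),
    vf_commute V1 V2 ->
    vf_indep_at V1 V2 p ->
    leaf_param V1 V2 p phi ->
    pscomp F phi <> ps0 R ->
    pscomp G phi <> ps0 R ->
    common_factor_split (pscomp F phi) (pscomp G phi) hf f hg g ->
    colength_le f g
      (B n (vdegree V1) (vdegree V2) (mdegree F) (mdegree G)).
Proof.
have [B BP] := choice (fun x : nat * nat * nat * nat * nat =>
  bounded_colength R x.1.1.1.1 x.1.1.1.2 x.1.1.2 x.1.2 x.2).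
exists (fun n v1 v2 df dg => B (n, v1, v2, df, dg)).
move=> n V1 V2 F G p phi hf f hg g _ _.
exact: (BP (n, vdegree V1, vdegree V2, mdegree F, mdegree G)
  V1 V2 F G p phi hf f hg g).
Qed.
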